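(* Let $n$ be a positive integer and $d$ a degree sequence. For nonnegative integers $i,j,m$, let $NC_{B_n^d}(i,j,m)$ be the number of permutations $\sigma\in B_n^d$ with $\mathrm{cro}^*_B(\sigma)=i$, $\mathrm{nes}^*_B(\sigma)=j$ and $\mathrm{neg}(\sigma)=m$. Then $NC_{B_n^d}(i,j,m)=NC_{B_n^d}(j,i,m)$ for all $i,j,m$.
   Context: For a positive integer $n$, $[n]=\{1,\dots,n\}$ and $[-n,n]=\{-n,\dots,-1,1,\dots,n\}$ with the natural order of $\mathbb{Z}$. $B_n$ is the set of sequences $\sigma=(\sigma(1),\dots,\sigma(n))$ of integers with $\{|\sigma(1)|,\dots,|\sigma(n)|\}=[n]$, identified with a permutation of $[-n,n]$ via $\sigma(-i)=-\sigma(i)$; $\mathrm{neg}(\sigma)$ is the number of negative entries among $\sigma(1),\dots,\sigma(n)$. The permutation diagram of $\sigma$ places $-n,\dots,-1,1,\dots,n$ left to right on a line, with an arc from $i$ to $\sigma(i)$ for each $i\in[-n,n]$, above the line if $i\le\sigma(i)$ and below otherwise. The upper permutation diagram $Upp(\sigma)$ is the set of arcs above the line, except that no loop is placed at a vertex $i<0$ with $\sigma(i)=i$. The degree sequence of $Upp(\sigma)$ is the sequence $(\mathrm{indegree}_\sigma(i),\mathrm{outdegree}_\sigma(i))_{i\in[-n,n]}$ (in the order $-n,\dots,-1,1,\dots,n$), where $\mathrm{indegree}_\sigma(i)$ (resp. $\mathrm{outdegree}_\sigma(i)$) is the number of arcs of $Upp(\sigma)$ joining $i$ to a vertex $j<i$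 (resp. $j>i$). For example, $\sigma=(4,5,6,2,-3,-1)$ has degree sequence $(0,1)(0,1)(0,1)(0,0)(1,0)(0,0)(1,1)(0,1)(1,1)(1,0)(1,0)(1,0)$. $B_n^d$ is the set of $\sigma\in B_n$ whose upper permutation diagram has degree sequence $d$. A set $\{a_1,\dots,a_k\}\subseteq[n]$ is a $k$-crossing of $\sigma$ if $a_1<\dots<a_k\le\sigma(a_1)<\dots<\sigma(a_k)$, or $-a_1<a_2<\dots<a_k\le-\sigma(a_1)<\sigma(a_2)<\dots<\sigma(a_k)$, or $\sigma(a_k)<\sigma(a_{k-1})<\dots<\sigma(a_1)<a_k<a_{k-1}<\dots<a_1$. It is a $k$-nesting of $\sigma$ if $a_1<\dots<a_k\le\sigma(a_k)<\sigma(a_{k-1})<\dots<\sigma(a_1)$, or $-a_1<a_2<\dots<a_k\le-\sigma(a_k)<\sigma(a_{k-1})<\dots<\sigma(a_1)$, or $\sigma(a_k)<\sigma(a_{k-1})<\dots<\sigma(a_1)<a_1<a_2<\dots<a_k$. $\mathrm{cro}^*_B(\sigma)$ (resp. $\mathrm{nes}^*_B(\sigma)$) is the largest $k$ such that $\sigma$ contains a $k$-crossing (resp. $k$-nesting).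
   Formalization: As printed false (e.g. (-1,2)). Here a loop at i>0 has degree (1,1); the second nesting clause ends a_k<=s(a_k)<...<s(a_2)<-s(a_1); second clauses of crossings and nestings allow any number r (1<=r<k) of arcs from negative vertices, not just one. *)

(* Defs.v *)
From mathcomp Require Import all_boot all_order all_algebra all_fingroup.

Set Implicit Arguments.
Unset Strict Implicit.
Unset Printing Implicit Defensive.

Import Order.TTheory GRing.Theory Num.Theory.
Local Open Scope ring_scope.

(* [-n,n] = {-n,...,-1,1,...,n}: (false, i) stands for i+1 and (true, i) for
   -(i+1), where i : 'I_n ranges over 0, ..., n-1. *)
Notation vertex n := (bool * 'I_n)%type.

Definition vpos (n : nat) (i : 'I_n) : vertex n := (false, i).

Definition vopp (n : nat) (v : vertex n) : vertex n := (~~ v.1, v.2).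

Definition lab (n : nat) (v : vertex n) : int :=
  if v.1 then - (v.2.+1)%:Z else (v.2.+1)%:Z.

Definition vertices (n : nat) : seq (vertex n) :=
  [seq vopp (vpos i) | i <- rev (enum 'I_n)] ++ [seq vpos i | i <- enum 'I_n].

Definition Bn (n : nat) : {set {perm (vertex n)}} :=
  [set s : {perm (vertex n)} | [forall v, s (vopp v) == vopp (s v)]].

Definition neg (n : nat) (s : {perm (vertex n)}) : nat :=
  #|[set i : 'I_n | lab (s (vpos i)) < 0]|.

Definition Upp (n : nat) (s : {perm (vertex n)}) : {set vertex n * vertex n} :=
  [set e | [&& e.2 == s e.1, lab e.1 <= lab e.2
             & ~~ ((lab e.1 < 0) && (s e.1 == e.1))]].

Definition joins (n : nat) (e : vertex n * vertex n) (v w : vertex n) : bool :=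
  (e == (v, w)) || (e == (w, v)).

(* The comparisons are weak: the loop of Upp(s) at a positive fixed point
   counts once as incoming and once as outgoing, so that such a vertex has
   degree (1,1).  With strict comparisons it would have degree (0,0), and the
   symmetry of crossings and nestings would fail: (1,-2) would be alone in its
   degree class, with a largest crossing of size 1 and a largest nesting of
   size 2. *)
Definition indegree (n : nat) (s : {perm (vertex n)}) (v : vertex n) : nat :=
  #|[set e in Upp s | [exists w, joins e v w && (lab w <= lab v)]]|.

Definition outdegree (n : nat) (s : {perm (vertex n)}) (v : vertex n) : nat :=
  #|[set e in Upp s | [exists w, joins e v w && (lab v <= lab w)]]|.

Definition degree_sequence (n : nat) (s : {perm (vertex n)}) : seq (nat * nat) :=
  [seq (indegree s v, outdegree s v) | v <- vertices n].

Definition increasing (xs : seq int) : bool := sorted (fun x y => x < y) xs.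

(* x_1 < ... < x_k <= y_1 < ... < y_k *)
Definition chain (xs ys : seq int) : bool :=
  [&& increasing xs, increasing ys & last 0 xs <= head 0 ys].

(* -a_1, ..., -a_r, a_{r+1}, ..., a_k *)
Definition signed (n : nat) (r : nat) (a : seq 'I_n) : seq (vertex n) :=
  [seq vopp (vpos i) | i <- take r a] ++ [seq vpos i | i <- drop r a].

Definition labs (n : nat) (vs : seq (vertex n)) : seq int := map (@lab n) vs.

(* Each a in [n] accounts for exactly one arc of Upp(s): a -> s(a) if
   a <= s(a), and -a -> -s(a) otherwise.  A set is a crossing (nesting) when
   its arcs are mutually crossing (nested): the three cases below are those
   where all, some or none of the arcs start at a positive vertex.  In the
   mixed case the number r of arcs starting at a negative vertex is arbitrary,
   the conditions being
     -a_1 < ... < -a_r < a_{r+1} < ... < a_k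
          <= -s(a_1) < ... < -s(a_r) < s(a_{r+1}) < ... < s(a_k)
   for crossings and
     -a_1 < ... < -a_r < a_{r+1} < ... < a_k
          <= s(a_k) < ... < s(a_{r+1}) < -s(a_r) < ... < -s(a_1)
   for nestings.  If only r = 1 were allowed, the symmetry would fail: for the
   degree sequence (0,1)(0,1)(0,0)(0,0)(1,1)(1,1)(1,0)(1,0), exactly one signed
   permutation would have largest crossing 1 and largest nesting 2, and none
   the reverse.  (If in the nesting condition the sign sat on s(a_k), as in
   -a_1 < a_2 < ... < a_k <= -s(a_k) < s(a_{k-1}) < ... < s(a_1), the arcs
   -1 -> 1 and 2 -> 2 of (-1,2), which are disjoint, would form a nesting, and
   the symmetry would already fail for n = 2.) *)
Definition crossing_seq (n : nat) (s : {perm (vertex n)}) (a : seq 'I_n) : bool :=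
  let x r := labs (signed r a) in
  let y r := labs (map s (signed r a)) in
  [|| chain (x 0%N) (y 0%N),
      [exists r : 'I_(size a), (0 < r)%N && chain (x r) (y r)]
    | increasing (rev (y 0%N) ++ rev (x 0%N))].

Definition nesting_seq (n : nat) (s : {perm (vertex n)}) (a : seq 'I_n) : bool :=
  let x r := labs (signed r a) in
  let y r := labs (map s (signed r a)) in
  [|| chain (x 0%N) (rev (y 0%N)),
      [exists r : 'I_(size a), (0 < r)%N && chain (x r) (rev (y r))]
    | increasing (rev (y 0%N) ++ x 0%N)].

Definition is_crossing (n : nat) (s : {perm (vertex n)}) (A : {set 'I_n}) : bool :=
  [exists a : #|A|.-tuple 'I_n, ([set i in a] == A) && crossing_seq s a].

Definition is_nesting (n : nat) (s : {perm (vertex n)}) (A : {set 'I_n}) : bool :=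
  [exists a : #|A|.-tuple 'I_n, ([set i in a] == A) && nesting_seq s a].

Definition cro (n : nat) (s : {perm (vertex n)}) : nat :=
  (\max_(A : {set 'I_n} | is_crossing s A) #|A|)%N.

Definition nes (n : nat) (s : {perm (vertex n)}) : nat :=
  (\max_(A : {set 'I_n} | is_nesting s A) #|A|)%N.

Definition Bnd (n : nat) (d : seq (nat * nat)) : {set {perm (vertex n)}} :=
  [set s : {perm (vertex n)} in Bn n | degree_sequence s == d].

Definition NC (n : nat) (d : seq (nat * nat)) (i j m : nat) : nat :=
  #|[set s in Bnd n d | [&& cro s == i, nes s == j & neg s == m]]|.

(* Main.v *)
(* The n arcs of Upp(s) match openers (sources) with closers (targets).  The degree
   sequence records which vertices are openers and which are closers, and this also
   determines neg(s).  Listing, opener after opener, the rank of the closer in decreasing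
   order makes s a rook placement on a Ferrers board; crossings become decreasing and
   nestings increasing subsequences inside a rectangle of the board.  Read from left to
   right, the labels of the arcs that are currently open form a word whose Schensted
   tableau gains a cell when an arc opens and loses its largest entry when an arc closes.
   Every sequence of shapes with such steps comes from exactly one placement.  By
   Schensted's theorem, bounds on crossings and nestings are bounds on the numbers of rows
   and columns of the shapes, so conjugating all the shapes exchanges the two statistics. *)

Require Import Defs.
From mathcomp Require Import all_boot all_order all_algebra all_fingroup zify.

Set Implicit Arguments.
Unset Strict Implicit.
Unset Printing Implicit Defensive.

(** * Row insertion on lattice words *)

(** No bijection between the two classes is written down. Induction on the events shows that the
    number of placements leading to a given tableau of open arcs depends only on its shape
    ([count_fillings]): an insertion is undone uniquely once the smaller shape is prescribed, and so
    is the loss of the largest entry once the larger shape is prescribed. What remains is a number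
    of walks among shapes, which conjugation preserves while exchanging the two bounds.

    Arcs that mutually cross or nest are all open when the last of them has just opened, so the
    bounds are tested at openings only. At a vertex carrying both events the sign decides their
    order: a positive vertex opens first and may carry a loop, a negative one closes first. This is
    the difference between the weak and the strict inequality in the definitions of chains.

    The walks control upper bounds on the two statistics; their exact values are recovered at the
    end by inclusion-exclusion. *)

Definition cnt (i : nat) (s : seq nat) : nat := count_mem i s.

Lemma cnt_nil i : cnt i [::] = 0. Proof. by []. Qed.

Lemma cnt_cons i j s : cnt i (j :: s) = (j == i) + cnt i s. Proof. by []. Qed.

Arguments cnt : simpl never.

(* A standard tableau with entries among 0, ..., m-1 is encoded by the word t of size m
   with t_x = 0 if x is not an entry and t_x = j+2 if x lies in row j.  Row insertion of v
   is a single scan: the marker 1 is put at position v, and with carry e the next letter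
   equal to e is the entry bumped from that row; it becomes e+1, the letter looked for
   afterwards. *)
Fixpoint bump_rows (e : nat) (s : seq nat) : seq nat :=
  if s is j :: s' then
    if j == e then e.+1 :: bump_rows e.+1 s' else j :: bump_rows e s'
  else [::].

Fixpoint carry (e : nat) (s : seq nat) : nat :=
  if s is j :: s' then carry (if j == e then e.+1 else e) s' else e.

Lemma size_bump_rows e s : size (bump_rows e s) = size s.
Proof. by elim: s e => //= j s IHs e; case: ifP => _ /=; rewrite IHs. Qed.

Lemma take_bump_rows k e s : take k (bump_rows e s) = bump_rows e (take k s).
Proof.
elim: s e k => [|j s IHs] e [|k] //=; first by case: ifP.
by case: ifP => _ /=; rewrite IHs.
Qed.

Lemma bump_rows_id e s : e \notin s -> bump_rows e s = s.
Proof.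
elim: s => //= j s IHs; rewrite inE negb_or eq_sym => /andP[/negbTE-> es].
by rewrite IHs.
Qed.

Lemma leq_carry e s : e <= carry e s.
Proof.
elim: s e => //= j s IHs e; apply: leq_trans (IHs _).
by case: ifP => _ //; apply: leqnSn.
Qed.

(** Conservation law of the scan: the letters written and the initial carry have the same content as
    the letters read and the final carry. *)
Lemma cnt_bump_rows (e : nat) (s : seq nat) (i : nat) :
  (e == i) + cnt i (bump_rows e s) = (carry e s == i) + cnt i s.
Proof.
elim: s e => [|j s IHs] e //=.
by rewrite cnt_cons; case: (eqVneq j e) => [->|je] /=; rewrite cnt_cons; [have := IHs e.+1 | have := IHs e]; lia.
Qed.

(** A written letter equals the carry after it exactly when a bump took place, so the scan can be
    traced back from its final carry. *)
Lemma bump_rows_inj (e1 e2 : nat) (s1 s2 : seq nat) :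
  bump_rows e1 s1 = bump_rows e2 s2 -> carry e1 s1 = carry e2 s2 -> e1 = e2 /\ s1 = s2.
Proof.
elim: s1 e1 e2 s2 => [|j1 s1 IHs] e1 e2 [|j2 s2] //=.
- by case: ifP.
- by case: ifP.
case: (eqVneq j1 e1) => [->|/eqP j1e]; case: (eqVneq j2 e2) => [->|/eqP j2e] [ej eb] ec;
  by have [ee es] := IHs _ _ _ eb ec; rewrite es; split; try congr (_ :: _); lia.
Qed.

Definition add_cell (f : nat -> nat) (e i : nat) : nat := f i + (e == i).

(* The letters 0 and 1 are not rows and are left unconstrained. *)
Definition nonincreasing_rows (f : nat -> nat) := forall i, f i.+3 <= f i.+2.

(** For [f = 0] this is the Yamanouchi condition: for every [k] the entries below [k] fill a Young
    diagram. The offset [f] records a prefix already read. *)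
Definition lattice (f : nat -> nat) (s : seq nat) :=
  forall k, nonincreasing_rows (fun i => f i + cnt i (take k s)).

Lemma eq_lattice f g (s : seq nat) : (forall i, f i.+2 = g i.+2) -> lattice f s -> lattice g s.
Proof. by move=> fg fs k i; rewrite -!fg; apply: fs. Qed.

Lemma lattice_nonincreasing f s : lattice f s -> nonincreasing_rows f.
Proof. by move=> fs i; have := fs 0 i; rewrite take0 !cnt_nil !addn0. Qed.

Lemma lattice_cons f j s : lattice f (j :: s) <-> nonincreasing_rows f /\ lattice (add_cell f j) s.
Proof.
split=> [fjs | [f0 fjs] [|k] i /=]; last 2 first.
- by rewrite !cnt_nil !addn0; apply: f0.
- by have := fjs k i; rewrite /add_cell !cnt_cons; lia.
split=> [|k i]; first exact: lattice_nonincreasing fjs.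
by have := fjs k.+1 i; rewrite /add_cell /= !cnt_cons; lia.
Qed.

(** The prefix written has one cell more than the prefix read, in the row of the current carry; a
    bump moves this extra cell one row down. *)
Lemma lattice_bump_rows f e s : 0 < e ->
  lattice f s -> nonincreasing_rows (add_cell f e) -> lattice (add_cell f e) (bump_rows e s).
Proof.
elim: s f e => [|j s IHs] f e e0 fs fe /=.
  by move=> k i; rewrite /= !cnt_nil !addn0; apply: fe.
move/lattice_cons: fs => [f0 fs]; case: (eqVneq j e) => [je|/eqP je].
  apply/lattice_cons; split=> //; rewrite je in fs; apply: IHs => // i.
  have := f0 i; have := fe i; rewrite /add_cell.
  by case: (eqVneq i.+2 e) => [<-|]; lia.
apply/lattice_cons; split=> //.
have: lattice (add_cell (add_cell f j) e) (bump_rows e s).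
  apply: IHs => // i; have := f0 i; have := fe i; have := lattice_nonincreasing fs i.
  by rewrite /add_cell; lia.
by apply: eq_lattice => i; rewrite /add_cell; lia.
Qed.

(* The scan is run backwards from its final carry e'. *)
Lemma unbump_rows f g' e' s :
    1 \notin s -> 0 < e' -> 0 < f 1 -> lattice f s -> nonincreasing_rows g' ->
    (forall i, f i + cnt i s = add_cell g' e' i) ->
  exists e g s1, [/\ 0 < e, forall i, f i = add_cell g e i, lattice g s1, bump_rows e s1 = s
                   & carry e s1 = e'].
Proof.
move=> s1 e0; elim: s f s1 => [|j s IHs] f /= s1 f1 fs g0 fg.
  exists e', g', [::]; split=> //.
  - by move=> i; rewrite -fg cnt_nil addn0.
  - by move=> k i; rewrite /= !cnt_nil !addn0; apply: g0.
move: s1; rewrite inE negb_or => /andP[/eqP j1 s1]; move/lattice_cons: fs => [f0 fs].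
have [] := IHs (add_cell f j) s1 _ fs g0.
- by rewrite /add_cell; lia.
- by move=> i; rewrite -fg /add_cell cnt_cons; lia.
move=> e [g [t [e_gt0 fge gt <- <-]]].
case: (eqVneq e j) => [ej | /eqP ej].
  have j2 : 1 < j by lia.
  (* Row [j] is nonempty, hence so is the preceding row; for [j = 2] the hypothesis on [f 1] takes
     over. *)
  have fj : 0 < f j.-1.
    case: j j2 j1 fs {IHs fg ej} fge => // -[|[|j]] // _ _ fs _.
    by have := lattice_nonincreasing fs j; rewrite /add_cell /=; lia.
  have fgE i : f i = g i by have := fge i; rewrite /add_cell ej; lia.
  exists j.-1, (fun i => f i - (j.-1 == i)), (j.-1 :: t); split; try lia.
  - by move=> i; rewrite /add_cell; case: eqVneq => [<-|]; lia.
  - apply/lattice_cons; split.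
      move=> i; have := f0 i; have := lattice_nonincreasing fs i; rewrite /add_cell; lia.
    apply: eq_lattice gt => i; rewrite -fgE /add_cell.
    by case: eqVneq => [<-|]; lia.
  - by rewrite /= eqxx prednK ?ej //; lia.
  - by rewrite /= eqxx prednK ?ej //; lia.
have fe : 0 < f e by have := fge e; rewrite /add_cell; lia.
exists e, (fun i => f i - (e == i)), (j :: t); split=> //.
- by move=> i; rewrite /add_cell; case: eqVneq => [<-|]; lia.
- apply/lattice_cons; split.
    move=> i; have := f0 i; have := lattice_nonincreasing gt i.
    by have := fge i.+3; have := fge i.+2; rewrite /add_cell; lia.
  by apply: eq_lattice gt => i; have := fge i.+2; rewrite /add_cell; case: eqVneq => [<-|]; lia.
- by rewrite /= eq_sym (introF eqP ej).
- by rewrite /= eq_sym (introF eqP ej).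
Qed.

(* In the reading word of a tableau, a decreasing subsequence takes its letters, listed
   in increasing order, from strictly increasing rows: its length is measured by an
   increasing subsequence of the encoding. *)
Fixpoint longest_inc (c : nat) (s : seq nat) : nat :=
  if s is j :: s' then
    if c < j then maxn (longest_inc c s') (longest_inc j s').+1 else longest_inc c s'
  else 0.

Lemma longest_inc_mono c d s : c <= d -> longest_inc d s <= longest_inc c s.
Proof.
elim: s c d => //= j s IHs c d cd; have := IHs _ _ cd.
by case: (ltnP d j); case: (ltnP c j); lia.
Qed.

Lemma longest_inc_pred c s : longest_inc c s <= (longest_inc c.+1 s).+1.
Proof.
elim: s => //= j s IHs; case: (ltnP c.+1 j); case: (ltnP c j); try lia.
move=> jc cj; have -> : j = c.+1 by lia.
by rewrite geq_max IHs /=.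
Qed.

(* Only the first two clauses are used below; the third one carries the induction. *)
Lemma longest_inc_bump_rows e s : 0 < e ->
  [/\ forall c, c < e -> longest_inc c (bump_rows e s) = longest_inc c s,
      longest_inc e (bump_rows e s) = longest_inc e.-1 s &
      forall c, e < c -> longest_inc c s <= longest_inc c (bump_rows e s) /\
        (longest_inc c (bump_rows e s) <= longest_inc c s \/ longest_inc c (bump_rows e s) + (c - e) <= longest_inc e.-1 s)].
Proof.
elim: s e => [|j s IHs] e e0 /=; first by split=> // c _; split=> //; left.
case: (eqVneq j e) => [->|/eqP je].
  have [I1 I2 I3] := IHs e.+1 isT; rewrite /= in I2 I3; split=> /=.
  - by move=> c ce; rewrite I2 I1 ?ifT; lia.
  - rewrite ltnSn I2 I1 // ifT; last lia.
    by have := longest_inc_pred e.-1 s; rewrite prednK //; lia.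
  move=> c ec; have [A B] : c < e.+1 = false /\ c < e = false.
    by split; apply/negbTE; rewrite -leqNgt ?(ltnW ec).
  have C : e.-1 < e by rewrite prednK.
  rewrite A B C.
  case: (eqVneq c e.+1) => [->|/eqP ce].
    rewrite I2; split; first exact: longest_inc_mono.
    by right; lia.
  have [J1 J2] := I3 c ltac:(lia); split=> //.
  by case: J2; [left | right; lia].
have [I1 I2 I3] := IHs e e0; split=> /=.
- move=> c ce; case: ltnP => [cj|jc]; last by rewrite I1.
  case: (ltnP j e) => ej; first by rewrite !I1.
  have [J1 J2] := I3 j ltac:(lia); rewrite I1 //.
  by have := @longest_inc_mono c e.-1 s ltac:(lia); lia.
- case: ltnP => ej; last by rewrite ifF ?I2; lia.
  rewrite ifT ?I2; last lia.
  by have [J1 J2] := I3 j ltac:(lia); lia.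
move=> c ec; have [J1 J2] := I3 c ec.
case: (ltnP c j) => cj; last by split=> //; case: ifP; lia.
have [K1 K2] := I3 j ltac:(lia); split; first lia.
rewrite ifT; last lia.
by lia.
Qed.

Lemma longest_inc_le c B s : c <= B -> all (fun x => x <= B) s -> longest_inc c s + c <= B.
Proof.
elim: s c => //= j s IHs c cB /andP[jB sB]; case: ifP => cj; last exact: IHs.
by have := IHs _ cB sB; have := IHs _ jB sB; lia.
Qed.

Lemma longest_inc_ge c s q :
  subseq q s -> sorted ltn q -> all (fun x => c < x) q -> size q <= longest_inc c s.
Proof.
elim: s c q => [|j s IHs] c [|x q] //=.
case: eqP => [->|_] qs xq /andP[cx cq].
  rewrite cx leq_max; apply/orP; right; apply: IHs => //; first exact: path_sorted xq.
  by apply: order_path_min xq; apply: ltn_trans.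
have := IHs c (x :: q) qs xq; rewrite /= cx cq => /(_ isT).
by case: ifP; lia.
Qed.


Lemma mem_cnt i s : (i \in s) = (0 < cnt i s).
Proof. by rewrite /cnt -has_count has_pred1. Qed.

Lemma cnt_rcons i j s : cnt i (rcons s j) = cnt i s + (j == i).
Proof. by rewrite /cnt -cats1 count_cat /= addn0. Qed.

Lemma cnt_cat i s t : cnt i (s ++ t) = cnt i s + cnt i t.
Proof. exact: count_cat. Qed.

Lemma cnt_size i s : cnt i s <= size s.
Proof. exact: count_size. Qed.

Definition lattice0 := lattice (fun=> 0).

Lemma lattice_take f s k : lattice f s -> lattice f (take k s).
Proof. by move=> fs l i; rewrite -take_min; apply: fs. Qed.

Lemma lattice0_nonincreasing s : lattice0 s -> nonincreasing_rows (fun i => cnt i s).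
Proof. by move=> fs i; have := fs (size s) i; rewrite take_size. Qed.

Lemma lattice_rcons s j :
  lattice0 (rcons s j) <-> lattice0 s /\ nonincreasing_rows (add_cell (fun i => cnt i s) j).
Proof.
split=> [sj | [ss sj] k].
  split; last by move=> i; have := lattice0_nonincreasing sj i; rewrite !cnt_rcons.
  by have := lattice_take (size s) sj; rewrite -cats1 take_size_cat.
case: (leqP k (size s)) => ks; first by rewrite -cats1 takel_cat //; apply: ss.
rewrite take_oversize ?size_rcons // => i; rewrite !cnt_rcons !add0n.
exact: sj.
Qed.

(** In a lattice word the first letter of a row comes after some letter of the preceding row; the
    induction continues in the prefix before it. *)
Lemma lattice_subseq_iota i s : lattice0 s -> i.+2 \in s -> subseq (iota 2 i.+1) s.
Proof.
elim: i s => [|i IHi] s ss is_in; first by rewrite sub1seq.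
set k := index i.+3 s; have ks : k < size s by rewrite index_mem.
have Ek : take k.+1 s = rcons (take k s) i.+3.
  by rewrite (take_nth 0) // nth_index.
have i2 : i.+2 \in take k s.
  have := ss k.+1 i; rewrite !add0n Ek !cnt_rcons mem_cnt eqxx; lia.
have sub := IHi _ (lattice_take k ss) i2; rewrite -(cat_take_drop k.+1 s) Ek.
apply: subseq_trans (prefix_subseq _ _).
have -> : iota 2 i.+2 = rcons (iota 2 i.+1) i.+3 by rewrite -[in LHS](addn1 i.+1) iotaD -cats1.
by rewrite -!cats1 cat_subseq.
Qed.

Lemma lattice_longest_inc i s : lattice0 s -> i.+2 \in s -> i < longest_inc 1 s.
Proof.
move=> ss /(lattice_subseq_iota ss) sub.
have := @longest_inc_ge 1 s (iota 2 i.+1) sub (iota_ltn_sorted _ _).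
rewrite size_iota; apply; apply/allP => x; rewrite mem_iota; lia.
Qed.

Lemma lattice_size i s : lattice0 s -> i.+2 \in s -> i < size s.
Proof. by move=> ss /(lattice_subseq_iota ss)/size_subseq; rewrite size_iota. Qed.

(** * Insertion of a letter and the tableau of a word *)

Definition row_insert (t : seq nat) (v : nat) : seq nat := bump_rows 1 (set_nth 0 t v 1).

Definition tableau (m : nat) (t : seq nat) := [/\ size t = m, 1 \notin t & lattice0 t].

Lemma ltn_carry (e : nat) s : e \in s -> e < carry e s.
Proof.
elim: s => //= j s IHs; rewrite inE eq_sym; case: eqP => [_ _ | _ /IHs //].
exact: leq_carry.
Qed.

Lemma nth_bump_rows e s x : 0 < e -> (nth 0 (bump_rows e s) x == 0) = (nth 0 s x == 0).
Proof.
elim: s e x => [|j s IHs] e x e0 //=; case: (eqVneq j e) => [->|_].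
  by case: x => [|x] /=; [case: e e0 | exact: IHs].
by case: x => //= x; apply: IHs.
Qed.

Lemma set_nthE t v : v < size t -> set_nth 0 t v 1 = take v t ++ 1 :: drop v.+1 t.
Proof.
elim: t v => [|j s IHs] [|u] //= us; first by rewrite drop0.
by rewrite IHs.
Qed.

Lemma take_set_nth t v k : v < size t -> take k (set_nth 0 t v 1) =
  if v < k then set_nth 0 (take k t) v 1 else take k t.
Proof.
elim: t v k => [|j s IHs] [|u] [|k] //= us.
by rewrite IHs // ltnS; case: ifP.
Qed.

Section SetNth.
Variables (t : seq nat) (v : nat).
Hypotheses (vt : v < size t) (tv : nth 0 t v = 0).

Lemma cat_take_cons0_drop : t = take v t ++ 0 :: drop v.+1 t.
Proof. by rewrite -{1}(cat_take_drop v t) (drop_nth 0) // tv. Qed.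

Lemma cnt_set_nth i : i != 0 -> cnt i (set_nth 0 t v 1) = cnt i t + (1 == i).
Proof.
move=> i0; rewrite (set_nthE vt) {3}cat_take_cons0_drop /cnt !count_cat /=.
by rewrite [0 == i]eq_sym (negbTE i0); lia.
Qed.

Lemma size_set_nth_marker : size (set_nth 0 t v 1) = size t.
Proof. by rewrite size_set_nth; apply/maxn_idPr. Qed.

Lemma cnt_take_set k i :
  cnt i.+2 (take k (set_nth 0 t v 1)) = cnt i.+2 (take k t).
Proof.
rewrite (set_nthE vt) [in RHS]cat_take_cons0_drop !take_cat; case: ifP => // _.
by case: (k - _) => //= l; rewrite /cnt !count_cat.
Qed.

Lemma lattice_set_nth : lattice0 (set_nth 0 t v 1) <-> lattice0 t.
Proof. by split=> tt k i; have := tt k i; rewrite !cnt_take_set. Qed.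

Lemma set_nthK : set_nth 0 (set_nth 0 t v 1) v 0 = t.
Proof.
rewrite set_set_nth eqxx; clear -vt tv; elim: t v vt tv => [|j s IHs] [|u] //=.
  by move=> _ ->.
by move=> us su; rewrite IHs.
Qed.

Lemma set_nth_index : 1 \notin t -> index 1 (set_nth 0 t v 1) = v.
Proof.
move=> t1; rewrite (set_nthE vt) index_cat ifF ?size_takel ?(ltnW vt) //= ?addn0 //.
by apply: contraNF t1; apply: mem_take.
Qed.

Lemma size_insert : size (row_insert t v) = size t.
Proof. by rewrite size_bump_rows size_set_nth_marker. Qed.

Lemma carry_gt1 : 1 < carry 1 (set_nth 0 t v 1).
Proof.
apply: ltn_carry.
by rewrite (set_nthE vt) mem_cat inE eqxx orbT.
Qed.

Lemma marker_notin_insert : 1 \notin t -> 1 \notin row_insert t v.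
Proof.
have := carry_gt1; have := cnt_bump_rows 1 (set_nth 0 t v 1) 1.
by rewrite cnt_set_nth // !mem_cnt /row_insert; lia.
Qed.

Lemma cnt_insert i :
  cnt i.+2 (row_insert t v) = cnt i.+2 t + (carry 1 (set_nth 0 t v 1) == i.+2).
Proof.
have := cnt_bump_rows 1 (set_nth 0 t v 1) i.+2.
by rewrite cnt_set_nth // /row_insert /=; lia.
Qed.

(** The scan runs from left to right, so entries below [k] are not affected by larger ones. *)
Lemma take_insert k : 1 \notin t ->
  take k (row_insert t v) = if v < k then row_insert (take k t) v else take k t.
Proof.
move=> t1; rewrite /row_insert take_bump_rows (take_set_nth _ vt); case: ifP => // _.
by apply: bump_rows_id; apply: contra t1 => /mem_take.
Qed.

Lemma tableau_insert m : tableau m t -> tableau m (row_insert t v).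
Proof.
case=> tm t1 tl; split; [by rewrite size_insert | exact: marker_notin_insert |].
have := @lattice_bump_rows (fun=> 0) 1 _ isT (lattice_set_nth.2 tl).
by move=> H; apply: eq_lattice (H _) => [i|i]; rewrite /add_cell.
Qed.

Lemma nth_insert x : (nth 0 (row_insert t v) x == 0) = (nth 0 t x == 0) && (x != v).
Proof.
rewrite /row_insert nth_bump_rows // nth_set_nth /=; case: (eqVneq x v) => [->|_]; last by rewrite andbT.
by rewrite andbF.
Qed.

End SetNth.

Definition rsk (m : nat) (p : seq nat) : seq nat := foldl row_insert (nseq m 0) p.

Lemma rsk_rcons m p v : rsk m (rcons p v) = row_insert (rsk m p) v.
Proof. exact: foldl_rcons. Qed.

Definition below (m : nat) (p : seq nat) := [seq x <- p | x < m].

Lemma tableau_nseq0 m : tableau m (nseq m 0).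
Proof.
split; rewrite ?size_nseq ?mem_nseq ?andbF //.
move=> k i; suff -> : cnt i.+3 (take k (nseq m 0)) = 0 by [].
by apply/count_memPn; apply/negP => /mem_take; rewrite mem_nseq andbF.
Qed.

Lemma tableau_rsk m p : uniq p -> all (fun x => x < m) p ->
  tableau m (rsk m p) /\ forall x, x < m -> (nth 0 (rsk m p) x == 0) = (x \notin p).
Proof.
elim/last_ind: p => [|p v IHp].
  by split=> [|x xm]; [exact: tableau_nseq0 | rewrite nth_nseq if_same].
rewrite rcons_uniq all_rcons => /andP[vp up] /andP[vm pm].
have [T N] := IHp up pm; have [sT T1 Tl] := T.
have vs : v < size (rsk m p) by rewrite sT.
have v0 : nth 0 (rsk m p) v = 0 by apply/eqP; rewrite N.
rewrite rsk_rcons; split=> [|x xm]; first exact: tableau_insert.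
by rewrite nth_insert // N // mem_rcons inE negb_or andbC.
Qed.

(** This turns the closing of the arc with the largest label into the removal of the last letter of
    the encoding. *)
Lemma take_rsk m k p : k <= m -> uniq p -> all (fun x => x < m) p ->
  take k (rsk m p) = rsk k (below k p).
Proof.
move=> km; elim/last_ind: p => [|p v IHp].
  by rewrite /rsk /= take_nseq.
rewrite rcons_uniq all_rcons => /andP[vp up] /andP[vm pm].
have [[sT T1 Tl] N] := tableau_rsk up pm.
rewrite rsk_rcons take_insert ?sT //.
rewrite /below filter_rcons IHp //; case: ifP => // _.
by rewrite rsk_rcons.
Qed.

(** Inverse row insertion: the cell to be removed ends the row with letter [e], and the scan is run
    backwards from the carry [e]. *)
Lemma insert_onto m t e g' : tableau m t -> 1 < e -> nonincreasing_rows g' ->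
    (forall i, cnt i.+2 t = g' i.+2 + (e == i.+2)) ->
  exists s v, [/\ tableau m s, v < m, nth 0 s v = 0, row_insert s v = t
    & forall i, cnt i.+2 s = g' i.+2].
Proof.
move=> [tm t1 tl] e1 g0 tg.
(* The offset [1 == i] stands for the carry with which an insertion starts; it forces the backward
   scan to end with the carry 1. *)
have [|||d [g [s [d0 fg gs sd ce]]]] :=
  @unbump_rows (fun i => 1 == i) (fun i => if i is j.+2 then g' j.+2 else (1 == i) + (cnt i t)) e t t1 (ltnW e1) isT.
- by apply: eq_lattice tl.
- by move=> i; apply: g0.
- by case=> [|[|i]]; rewrite /add_cell ?tg; lia.
have d1 : d = 1 by have := fg d; rewrite /add_cell; lia.
have g1 i : g i = 0 by have := fg i; rewrite d1 /add_cell; lia.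
subst d; have cs : cnt 1 s = 1.
  by have := cnt_bump_rows 1 s 1; rewrite sd ce; move: t1; rewrite mem_cnt; lia.
have s1 : 1 \in s by rewrite mem_cnt cs.
have sm : size s = m by rewrite -tm -sd size_bump_rows.
set v := index 1 s; have vm : v < size s by rewrite index_mem.
set s' := set_nth 0 s v 0.
have ss' : set_nth 0 s' v 1 = s.
  rewrite /s' set_set_nth eqxx; apply: (@eq_from_nth _ 0).
    by rewrite size_set_nth; apply/maxn_idPr.
  move=> i _; rewrite nth_set_nth /=; case: eqVneq => // ->.
  by rewrite nth_index.
have sz : size s' = size s by rewrite size_set_nth; apply/maxn_idPr.
have v0 : nth 0 s' v = 0 by rewrite nth_set_nth /= eqxx.
have c' i : i != 0 -> cnt i s = cnt i s' + (1 == i).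
  by move=> i0; rewrite -[in LHS]ss' cnt_set_nth ?sz.
have s'1 : 1 \notin s' by have := c' 1 isT; rewrite mem_cnt; lia.
have s's : row_insert s' v = t by rewrite /row_insert ss'.
exists s', v; split=> //; [|by rewrite -sm|move=> i].
  split; rewrite ?sz //; apply/(@lattice_set_nth s' v); rewrite ?sz // ss'.
  by apply: eq_lattice gs => i; rewrite g1.
have := cnt_insert (v:=v) (t:=s'); rewrite sz ss' ce s's => /(_ vm v0 i).
by rewrite tg; lia.
Qed.

(** Equal contents before and after the insertion force equal final carries, and then the scan is
    injective. *)
Lemma insert_inj m s1 s2 v1 v2 :
    tableau m s1 -> tableau m s2 -> v1 < m -> v2 < m ->
    nth 0 s1 v1 = 0 -> nth 0 s2 v2 = 0 ->
    (forall i, cnt i.+2 s1 = cnt i.+2 s2) -> row_insert s1 v1 = row_insert s2 v2 ->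
  s1 = s2 /\ v1 = v2.
Proof.
move=> [sm1 s11 sl1] [sm2 s21 sl2] vm1 vm2 v10 v20 cs eqi.
have [|_ es] := @bump_rows_inj 1 1 (set_nth 0 s1 v1 1) (set_nth 0 s2 v2 1) eqi.
  rewrite -sm1 in vm1; rewrite -sm2 in vm2.
  have := carry_gt1 vm1; set c := carry _ _ => c1.
  have := cnt_insert vm1 v10 c.-2; have := cnt_insert vm2 v20 c.-2.
  by rewrite cs eqi -/c; case: c c1 => [|[|c]] //= _; lia.
have vE : v1 = v2.
  by rewrite -(@set_nth_index s1 v1) ?sm1 // es set_nth_index ?sm2.
split=> //; rewrite -(@set_nthK s1 v1) ?sm1 // es vE.
by rewrite set_nthK ?sm2.
Qed.


(** * Increasing and decreasing subsequences *)

Lemma drop_bump_rows k e s : drop k (bump_rows e s) = bump_rows (carry e (take k s)) (drop k s).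
Proof.
elim: s k e => [|j s IHs] [|k] e //=; first by case: ifP.
by case: (j =P e) => _ /=; rewrite IHs.
Qed.

Lemma carry_id e s : e \notin s -> carry e s = e.
Proof.
elim: s => //= j s IHs; rewrite inE negb_or eq_sym => /andP[/negbTE-> es].
exact: IHs.
Qed.

Lemma longest_inc_pred_notin c s : c.+1 \notin s -> longest_inc c s = longest_inc c.+1 s.
Proof.
elim: s => //= j s IHs; rewrite inE negb_or => /andP[/eqP cj cs].
by rewrite IHs //; case: (ltnP c j); case: (ltnP c.+1 j) => //; lia.
Qed.

Lemma longest_inc_skip c x a b : x <= c -> longest_inc c (a ++ x :: b) = longest_inc c (a ++ b).
Proof.
elim: a c => [|j a IHa] c xc /=; first by rewrite ifF //; lia.
by case: ltnP => cj; rewrite ?IHa //; lia.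
Qed.

Lemma longest_inc_marker a b : 1 \notin a -> 1 \notin b ->
  longest_inc 0 (a ++ 1 :: b) = maxn (longest_inc 1 (a ++ b)) (longest_inc 1 b).+1.
Proof.
move=> a1 b1; elim: a a1 => [_|j a IHa] /=; first by rewrite longest_inc_pred_notin.
rewrite inE negb_or => /andP[/eqP j1 a1]; rewrite IHa //.
case: (ltnP 1 j) => j2; last by have -> : j = 0 by lia.
by rewrite (ltnW j2) longest_inc_skip ?(ltnW j2) // maxnAC.
Qed.

(** This is the recursion for decreasing subsequences with letters at least [y]: a new letter [v]
    extends those whose letters all exceed [v]. *)
Lemma longest_inc_insert (t : seq nat) (v y : nat) : 1 \notin t -> v < size t -> nth 0 t v = 0 ->
  longest_inc 1 (drop y (row_insert t v)) =
  if y <= v then maxn (longest_inc 1 (drop y t)) (longest_inc 1 (drop v.+1 t)).+1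
  else longest_inc 1 (drop y t).
Proof.
move=> t1 vt tv; rewrite /row_insert drop_bump_rows take_set_nth //.
have N (s : seq nat) : subseq s t -> 1 \notin s.
  by move=> st; apply: contra t1; apply: mem_subseq st _.
have tE := cat_take_cons0_drop vt tv; set a := take v t in tE; set b := drop v.+1 t in tE.
have a1 : 1 \notin a by apply: N; apply: take_subseq.
have b1 : 1 \notin b by apply: N; apply: drop_subseq.
have sa : size a = v by rewrite size_takel // ltnW.
case: (leqP y v) => yv; last first.
  have -> : drop y (set_nth 0 t v 1) = drop y t.
    by rewrite set_nthE // -/a -/b [in RHS]tE !drop_cat sa ltnNge ltnW //=; case: y yv => // y yv; rewrite subSn.
  set c := carry _ _; have c1 : 1 < c.
    apply: ltn_carry; rewrite set_nthE ?size_take; last by case: ifP.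
    by rewrite mem_cat inE eqxx orbT.
  by have [I _ _] := @longest_inc_bump_rows c (drop y t) (ltnW c1); rewrite I.
rewrite carry_id; last by apply: N; apply: take_subseq.
have [_ -> _] := @longest_inc_bump_rows 1 (drop y (set_nth 0 t v 1)) isT.
rewrite set_nthE // -/a -/b [in RHS]tE !drop_cat sa.
have -> : drop (y - v) (0 :: b) = 0 :: b by rewrite (eqP (_ : y - v == 0)).
have -> : drop (y - v) (1 :: b) = 1 :: b by rewrite (eqP (_ : y - v == 0)).
case: ltnP => yv'; last first.
  rewrite (_ : _ :: b = [::] ++ 1 :: b) // longest_inc_marker //=.
rewrite longest_inc_marker // ?longest_inc_skip //; last first.
  by apply: contra a1 => /mem_drop.
Qed.

(** Either the first row has an entry after [v], and a bump keeps its length, or [v] becomes its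
    last entry. *)
Lemma cnt2_insert (t : seq nat) (v : nat) : 1 \notin t -> v < size t -> nth 0 t v = 0 ->
  cnt 2 (row_insert t v) = maxn (cnt 2 t) (cnt 2 (take v t)).+1.
Proof.
move=> t1 vt tv; rewrite /row_insert set_nthE // [X in maxn (cnt 2 X)](cat_take_cons0_drop vt tv).
have H s s' : 1 \notin s -> bump_rows 1 (s ++ 1 :: s') = s ++ 2 :: bump_rows 2 s'.
  elim: s => //= j s IHs; rewrite inE negb_or eq_sym => /andP[/negbTE-> s1].
  by rewrite IHs.
rewrite H; last by apply: contra t1 => /mem_take.
set s := drop _ _; rewrite !cnt_cat !cnt_cons /=.
have := cnt_bump_rows 2 s 2; have := @ltn_carry 2 s; have := @bump_rows_id 2 s.
by rewrite mem_cnt; case: (cnt 2 s) => [->|c _ /(_ isT)]; lia.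
Qed.

Lemma cnt2_take_insert (t : seq nat) (v y : nat) : 1 \notin t -> v < size t -> nth 0 t v = 0 ->
  cnt 2 (take y (row_insert t v)) =
  if v < y then maxn (cnt 2 (take y t)) (cnt 2 (take v t)).+1
  else cnt 2 (take y t).
Proof.
move=> t1 vt tv; rewrite take_insert //; case: ltnP => // vy.
rewrite cnt2_insert ?nth_take ?take_takel // ?(ltnW vy) //; last first.
  by rewrite size_take; case: ifP.
by apply: contra t1 => /mem_take.
Qed.

Section Chains.
Variables (r : rel nat) (ok : nat -> pred nat) (nx : nat -> nat).
Variables (C : pred (seq nat)) (F : seq nat -> nat -> nat).
Hypothesis r_trans : transitive r.
Hypothesis ok_nx : forall v x, ok (nx v) x = r x v.
Hypothesis ok_r : forall y v x, ok y v -> r x v -> ok y x.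
Hypothesis C_rcons : forall p v, C (rcons p v) -> C p.
Hypothesis F_nil : forall y, F [::] y = 0.
Hypothesis F_rcons : forall p v y, C (rcons p v) ->
  F (rcons p v) y = if ok y v then maxn (F p y) (F p (nx v)).+1 else F p y.

Lemma sorted_rcons q v : sorted r (rcons q v) = all (r^~ v) q && sorted r q.
Proof. by rewrite !(sorted_pairwise r_trans) pairwise_rcons. Qed.

(** Common to both halves of Schensted's theorem. The number [y] is a threshold on the letters, and
    [nx v] is the threshold admitting exactly the letters that may precede [v]; the induction on [p]
    closes because all thresholds are treated at once. *)
Lemma chain_rec p y k : C p ->
  k <= F p y <-> exists q, [/\ subseq q p, sorted r q, all (ok y) q & size q = k].
Proof.
elim/last_ind: p y k => [|p v IHp] y k Cp.
  rewrite F_nil leqn0; split=> [/eqP->|[q [/eqP-> _ _ <-]] //].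
  by exists [::].
have IH := IHp _ _ (C_rcons Cp); rewrite F_rcons //; split.
  have old : k <= F p y -> exists q,
      [/\ subseq q (rcons p v), sorted r q, all (ok y) q & size q = k].
    move=> /IH[q [qp qs qy qk]]; exists q; split=> //.
    by apply: subseq_trans qp _; apply: subseq_rcons.
  case: ifP => // yv; rewrite leq_max => /orP[//|].
  case: k old => [_ _|k _]; first by exists [::]; rewrite sub0seq.
  rewrite ltnS => /IH[q [qp qs qy qk]]; exists (rcons q v); split.
  - by rewrite -!cats1 cat_subseq.
  - by rewrite sorted_rcons qs andbT; apply: sub_all qy => x; rewrite ok_nx.
  - by rewrite all_rcons yv; apply: sub_all qy => x; rewrite ok_nx; apply: ok_r.
  - by rewrite size_rcons qk.
case; elim/last_ind => [|q x _] [qp qs qy <-]; first by rewrite leq0n.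
case: (eqVneq x v) => [xv|xv].
  subst x; move: qy; rewrite all_rcons => /andP[-> qy].
  rewrite leq_max size_rcons; apply/orP; right; rewrite ltnS.
  move: qs; rewrite sorted_rcons => /andP[qv qs].
  apply/IH; exists q; split=> //; last by apply: sub_all qv => x; rewrite ok_nx.
  by move: qp; rewrite -!cats1 subseq_cat2r.
have : size (rcons q x) <= F p y.
  apply/IH; exists (rcons q x); split=> //.
  move: qp; rewrite -subseq_rev !rev_rcons /= (negbTE xv).
  by rewrite -rev_rcons subseq_rev.
by case: ifP => // _; rewrite leq_max => ->.
Qed.
End Chains.


Lemma lds_rsk m p k : uniq p -> all (fun x => x < m) p ->
  k <= longest_inc 1 (rsk m p) <-> exists q, [/\ subseq q p, sorted gtn q & size q = k].
Proof.
move=> up pm.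
have := @chain_rec gtn (fun y x => y <= x) succn
  (fun p => uniq p && all (fun x => x < m) p) (fun p y => longest_inc 1 (drop y (rsk m p))).
case/(_ _ _ _ _ _ _ p 0 k).
- by move=> y x z /= xy yz; apply: ltn_trans yz xy.
- by [].
- by move=> y v x yv /ltnW; apply: leq_trans.
- by move=> q v; rewrite rcons_uniq all_rcons => /andP[/andP[_ ->] /andP[_ ->]].
- by move=> y; rewrite /rsk /=; elim: m y {pm} => [|m' IHm] [|y] //=; rewrite -[nseq m' 0]drop0 IHm.
- move=> q v y; rewrite rcons_uniq all_rcons => /andP[/andP[vq uq] /andP[vm qm]].
  have [[st t1 tl] N] := tableau_rsk uq qm.
  by rewrite rsk_rcons longest_inc_insert ?st //; apply/eqP; rewrite N.
- by rewrite up pm.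
rewrite drop0 => H1 H2; split=> [/H1[q [? ? _ ?]]|[q [? ? ?]]]; first by exists q.
by apply: H2; exists q; split=> //; apply/allP.
Qed.

Lemma lis_rsk m p k : uniq p -> all (fun x => x < m) p ->
  k <= cnt 2 (rsk m p) <-> exists q, [/\ subseq q p, sorted ltn q & size q = k].
Proof.
move=> up pm.
have := @chain_rec ltn (fun y x => x < y) id
  (fun p => uniq p && all (fun x => x < m) p) (fun p y => cnt 2 (take y (rsk m p))).
case/(_ _ _ _ _ _ _ p m k).
- exact: ltn_trans.
- by [].
- by move=> y v x yv xv; apply: ltn_trans yv.
- by move=> q v; rewrite rcons_uniq all_rcons => /andP[/andP[_ ->] /andP[_ ->]].
- move=> y; apply/eqP; rewrite -leqn0 leqNgt -mem_cnt.
  by apply/negP => /mem_take; rewrite mem_nseq andbF.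
- move=> q v y; rewrite rcons_uniq all_rcons => /andP[/andP[vq uq] /andP[vm qm]].
  have [[st t1 tl] N] := tableau_rsk uq qm.
  by rewrite rsk_rcons cnt2_take_insert ?st //; apply/eqP; rewrite N.
- by rewrite up pm.
have [[st _ _] _] := tableau_rsk up pm.
rewrite take_oversize ?st // => H1 H2.
split=> [/H1[q [? ? _ ?]]|[q [qp ? ?]]]; first by exists q.
by apply: H2; exists q; split=> //; apply/allP => x /(mem_subseq qp)/(allP pm).
Qed.

(** * Shapes and fillings *)

Definition bounded_tableau (a b : nat) (t : seq nat) := (longest_inc 1 t <= a) && (cnt 2 t <= b).

(* The word r lists the events backwards: true opens an arc, false closes one, and m is
   the number of arcs still to be closed after these events.  An arc is labelled by the
   number of arcs closed after it, so that the arc being closed is always the one with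
   the largest label. *)
Fixpoint fillings (a b : nat) (r : seq bool) (m : nat) : seq (seq nat) :=
  match r with
  | [::] => [:: [::]]
  | true :: r' =>
      [seq K <- [seq rcons L v | L <- fillings a b r' m, v <- iota 0 m]
         | uniq K && bounded_tableau a b (rsk m (below m K))]
  | false :: r' => [seq L <- fillings a b r' m.+1 | m \in L]
  end.

Section Shapes.
Variable N : nat.
Notation cell := ('I_N * 'I_N)%type.

(** Shapes are confined to a square box to make sums over them finite; [N] will exceed the size of
    every tableau in play. *)
Definition diagram (f : nat -> nat) : {set cell} := [set c : cell | c.2 < f c.1.+2].

Definition shape (t : seq nat) : {set cell} := diagram (fun i => cnt i t).

Definition young (l : {set cell}) : bool :=
  [forall c : cell, forall c' : cell, (c \in l) ==> (c'.1 <= c.1) ==> (c'.2 <= c.2) ==> (c' \in l)].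

Lemma youngP (l : {set cell}) :
  reflect (forall c c' : cell, c \in l -> c'.1 <= c.1 -> c'.2 <= c.2 -> c' \in l)
          (young l).
Proof.
apply: (iffP forallP) => H c; first by move=> c' cl c1 c2;
  have /forallP/(_ c')/implyP/(_ cl)/implyP/(_ c1)/implyP := H c; apply.
by apply/forallP => c'; apply/implyP => cl; apply/implyP => c1; apply/implyP; apply: H cl c1.
Qed.

Definition covers (k l : {set cell}) := (k \subset l) && (#|l| == #|k|.+1).

Lemma coversP (k l : {set cell}) :
  reflect (exists2 c, c \notin k & l = c |: k) (covers k l).
Proof.
apply: (iffP andP) => [[kl /eqP lk] | [c ck ->]]; last first.
  by rewrite subsetUr cardsU1 ck.
have : #|l :\: k| == 1 by rewrite cardsD (setIidPr kl) lk subSnn.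
case/cards1P => c lc; exists c.
  by have : c \in l :\: k; [rewrite lc set11 | rewrite inE => /andP[]].
by rewrite -lc setUC -{1}(setID l k) (setIidPr kl).
Qed.

Lemma noninc_le f i j : nonincreasing_rows f -> i <= j -> f j.+2 <= f i.+2.
Proof.
by move=> f0 /subnKC <-; elim: (j - i) => [|k IHk]; rewrite ?addn0 // addnS (leq_trans _ IHk).
Qed.

Lemma young_diagram f : nonincreasing_rows f -> young (diagram f).
Proof.
move=> f0; apply/youngP => c c'; rewrite !inE => cf c1 c2.
by apply: leq_ltn_trans c2 (leq_trans cf _); apply: noninc_le.
Qed.

Lemma eq_diagram f g : (forall i, f i.+2 = g i.+2) -> diagram f = diagram g.
Proof. by move=> fg; apply/setP => c; rewrite !inE fg. Qed.

Lemma diagram_inj f g : (forall i, f i.+2 < N) -> (forall i, g i.+2 < N) ->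
  diagram f = diagram g -> forall i, i < N -> f i.+2 = g i.+2.
Proof.
move=> fN gN fg i iN; have E j : j < N -> (j < f i.+2) = (j < g i.+2).
  by move=> jN; have /setP/(_ (Ordinal iN, Ordinal jN)) := fg; rewrite !inE.
apply/eqP; rewrite eqn_leq; have := E _ (fN i); have := E _ (gN i).
by rewrite !ltnn; lia.
Qed.

Lemma diagram_adds f (e : 'I_N) (fN : f e.+2 < N) :
  diagram (add_cell f e.+2) = (e, Ordinal fN) |: diagram f.
Proof.
apply/setP => -[i j]; rewrite !inE /add_cell xpair_eqE -!val_eqE /=.
rewrite !eqSS eq_sym; case: (eqVneq (val i) (val e)) => [->|_] /=; last by rewrite addn0.
by rewrite addn1 ltnS leq_eqVlt.
Qed.

Lemma covers_adds f e : e < N -> f e.+2 < N -> covers (diagram f) (diagram (add_cell f e.+2)).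
Proof.
move=> eN fN; apply/coversP; exists (Ordinal eN, Ordinal fN).
  by rewrite inE /= ltnn.
exact: (@diagram_adds f (Ordinal eN)).
Qed.

Lemma covers_up f l : nonincreasing_rows f -> young l -> covers (diagram f) l ->
  exists e, [/\ e < N, nonincreasing_rows (add_cell f e.+2) & l = diagram (add_cell f e.+2)].
Proof.
move=> f0 /youngP yl /coversP[[e j] cf lE].
(* If the new cell were further to the right, the first missing cell of its row would have to belong
   to [l] as well. *)
have jf : j = f e.+2 :> nat.
  apply/eqP; rewrite eqn_leq; move: (cf); rewrite inE -leqNgt /= => ->.
  rewrite andbT leqNgt; apply/negP => fj.
  have /= := yl (e, j) (e, Ordinal (ltn_trans fj (ltn_ord j))).
  by rewrite lE !inE eqxx leqnn xpair_eqE -!val_eqE /= (ltnW fj) (ltn_eqF fj) andbF ltnn => /(_ isT isT isT).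
have fN : f e.+2 < N by rewrite -jf.
exists e; split=> //; last first.
  by rewrite diagram_adds lE; congr ((_, _) |: _); apply: val_inj.
move=> i; rewrite /add_cell; have := f0 i; case: (eqVneq e.+2 i.+3) => [ei|]; last by lia.
have iN : i < N by have := ltn_ord e; lia.
have /= := yl (e, j) (Ordinal iN, j); rewrite lE !inE eqxx leqnn xpair_eqE -val_eqE /=.
have -> : i == e = false by lia.
by move=> /(_ isT); rewrite jf -ei; lia.
Qed.

(** A cell to the right of the removed one, or just below it, would force the removed one to stay;
    so it ends its row and leaves a partition behind. *)
Lemma covers_down f l : nonincreasing_rows f -> (forall i, f i.+2 < N) -> f N.+2 = 0 ->
    young l -> covers l (diagram f) ->
  exists e g, [/\ nonincreasing_rows g, forall i, f i.+2 = g i.+2 + (e.+2 == i.+2) & l = diagram g].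
Proof.
move=> f0 fN fNN /youngP yl /coversP[[e j] cl fE].
have inl c : c \in l = (c != (e, j)) && (c \in diagram f).
  by rewrite fE !inE; case: eqP => //= ->; apply/negbTE.
have : (e, j) \in diagram f by rewrite fE setU11.
rewrite inE /= => jf.
have jE : f e.+2 = j.+1.
  apply/eqP; rewrite eqn_leq jf andbT leqNgt; apply/negP => fj.
  have jN : j.+1 < N by apply: ltn_trans (fN e).
  move/negP: cl; apply; apply: (yl (e, Ordinal jN)) => //=.
  by rewrite inl inE fj xpair_eqE -!val_eqE /= andbT; lia.
have fe : f e.+3 <= j.
  rewrite leqNgt; apply/negP => fj.
  case: (leqP N e.+1) => eN.
    have En : e.+1 = N by have := ltn_ord e; lia.
    by move: fj; rewrite En fNN ltn0.
  move/negP: cl; apply; apply: (yl (Ordinal eN, j)) => //=.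
  by rewrite inl inE fj xpair_eqE -!val_eqE /= andbT; lia.
have gE i : f i.+2 = f i.+2 - (e.+2 == i.+2) + (e.+2 == i.+2).
  by case: (eqVneq e.+2 i.+2) => [<-|]; lia.
exists e, (fun i => f i - (e.+2 == i)); split=> //.
  move=> i; have := f0 i; case: (eqVneq e.+2 i.+2) => [[ei]|]; last by lia.
  by rewrite -ei jE; lia.
apply/setP => -[i k]; rewrite inl !inE xpair_eqE -!val_eqE /=.
rewrite !eqSS [in RHS]eq_sym; case: (eqVneq (val i) (val e)) => [->|_] /=.
  by rewrite jE subn1 ltnS ltn_neqAle.
by rewrite subn0.
Qed.

Section Tab.
Variables (m : nat) (t : seq nat).
Hypotheses (mN : m < N) (tt : tableau m t).

Lemma tableau_cnt_lt i : cnt i.+2 t < N.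
Proof. by case: tt => tm _ _; apply: leq_ltn_trans mN; rewrite -tm; apply: cnt_size. Qed.

Lemma tableau_cnt_eq0 i : m <= i -> cnt i.+2 t = 0.
Proof.
case: tt => tm _ tl mi; apply/eqP; rewrite -leqn0 leqNgt -mem_cnt.
by apply/negP => /(lattice_size tl); rewrite tm ltnNge mi.
Qed.

Lemma young_shape : young (shape t).
Proof. by apply: young_diagram; case: tt => _ _ /lattice0_nonincreasing. Qed.

Lemma shape_cnt s : tableau m s -> shape t = shape s -> forall i, cnt i.+2 t = cnt i.+2 s.
Proof.
move=> ts st i; case: (ltnP i N) => iN; last first.
  rewrite tableau_cnt_eq0 ?(leq_trans (ltnW mN)) //.
  case: ts => sm _ sl; apply/esym/eqP; rewrite -leqn0 leqNgt -mem_cnt.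
  by apply/negP => /(lattice_size sl); rewrite sm ltnNge (leq_trans (ltnW mN)).
apply: diagram_inj st i iN; first exact: tableau_cnt_lt.
by move=> i; case: ts => sm _ _; apply: leq_ltn_trans mN; rewrite -sm; apply: cnt_size.
Qed.

End Tab.
End Shapes.


(** * Counting fillings by walks among shapes *)

Section Count.
Variable N : nat.
Notation cell := ('I_N * 'I_N)%type.

Definition fits (a b : nat) (l : {set cell}) : bool :=
  [forall c : cell, (c \in l) ==> (c.1 < a) && (c.2 < b)].

(** The trace of [fillings] on shapes. Closings need no test, as they make the shape smaller. *)
Fixpoint walks (a b : nat) (r : seq bool) (l : {set cell}) : nat :=
  match r with
  | [::] => l == set0
  | true :: r' => fits a b l * \sum_(k | young k && covers k l) walks a b r' k
  | false :: r' => \sum_(k | young k && covers l k) walks a b r' k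
  end.

Definition swap (c : cell) : cell := (c.2, c.1).

Lemma swapK : involutive swap. Proof. by case. Qed.

Definition conjugate (l : {set cell}) : {set cell} := swap @^-1: l.

Lemma in_conjugate l c : (c \in conjugate l) = (swap c \in l).
Proof. by rewrite inE. Qed.

Lemma conjugateK : involutive conjugate.
Proof. by move=> l; apply/setP => c; rewrite !in_conjugate swapK. Qed.

Lemma young_conjugate l : young (conjugate l) = young l.
Proof.
suff H k : young k -> young (conjugate k).
  by apply/idP/idP => [/H|/H //]; rewrite conjugateK.
move/youngP => yk; apply/youngP => c c'; rewrite !in_conjugate => ck c1 c2.
exact: (yk _ _ ck).
Qed.

Lemma card_conjugate l : #|conjugate l| = #|l|.
Proof. by rewrite on_card_preimset //; exists swap => c _; rewrite swapK. Qed.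

Lemma sub_conjugate k l : (conjugate k \subset conjugate l) = (k \subset l).
Proof.
apply/subsetP/subsetP => kl c; last by rewrite !in_conjugate; apply: kl.
by have := kl (swap c); rewrite !in_conjugate swapK.
Qed.

Lemma covers_conjugate k l : covers (conjugate k) (conjugate l) = covers k l.
Proof. by rewrite /covers sub_conjugate !card_conjugate. Qed.

Lemma fits_conjugate a b l : fits b a (conjugate l) = fits a b l.
Proof.
apply/forallP/forallP => H c.
  by have := H (swap c); rewrite in_conjugate swapK andbC.
by have := H (swap c); rewrite in_conjugate andbC.
Qed.

Lemma walks_conjugate a b r l : walks b a r (conjugate l) = walks a b r l.
Proof.
elim: r l => [|[] r IHr] l /=.
- by rewrite -!cards_eq0 card_conjugate.
- rewrite fits_conjugate (reindex_inj (inv_inj conjugateK)) /=; congr (_ * _).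
  by apply: eq_big => k; rewrite ?young_conjugate ?covers_conjugate.
rewrite (reindex_inj (inv_inj conjugateK)) /=.
by apply: eq_big => k; rewrite ?young_conjugate ?covers_conjugate.
Qed.

Lemma bounded_tableau_fits a b m t : m < N -> tableau m t -> bounded_tableau a b t = fits a b (shape N t).
Proof.
move=> mN tt; have [tm t1 tl] := tt.
apply/andP/forallP => [[ta tb] c | H]; last first.
  have cellH i j : j < cnt i.+2 t -> i < a /\ j < b.
    move=> ij; have iN : i < N.
      apply: leq_trans (ltnW mN); rewrite -tm; apply: lattice_size => //.
      by rewrite mem_cnt; case: (cnt _ _) ij.
    have jN : j < N by apply: ltn_trans ij (tableau_cnt_lt mN tt _).
    by have := H (Ordinal iN, Ordinal jN); rewrite inE /= ij => /andP.
  split; last by rewrite leqNgt; apply/negP => /(cellH 0)[_]; rewrite ltnn.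
  (* With at most [a] rows, the letters that count are 2, ..., a+1. *)
  suff : longest_inc 1 t + 1 <= a.+1 by rewrite addn1.
  apply: longest_inc_le => //; apply/allP => -[|[|i]] // it.
  by rewrite mem_cnt in it; have [] := cellH _ _ it.
apply/implyP; rewrite inE => ct; apply/andP; split.
  by apply: leq_trans ta; apply: lattice_longest_inc => //; rewrite mem_cnt; case: (cnt _ _) ct.
apply: leq_trans ct (leq_trans _ tb).
exact: (noninc_le (lattice0_nonincreasing tl) (leq0n _)).
Qed.

Lemma uniq_fillings a b r m L : L \in fillings a b r m -> uniq L.
Proof.
elim: r m L => [|[] r IHr] m L /=; first by rewrite inE => /eqP->.
  by rewrite mem_filter => /andP[/andP[]].
by rewrite mem_filter => /andP[_ /IHr].
Qed.

Lemma below_uniq m L : uniq L -> uniq (below m L) /\ all (fun x => x < m) (below m L).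
Proof. by move=> uL; rewrite filter_uniq // filter_all. Qed.

Lemma tableau_below m L : uniq L -> tableau m (rsk m (below m L)).
Proof. by move=> /(@below_uniq m)[? ?]; case: (@tableau_rsk m (below m L)). Qed.

Lemma nth_below m L x : uniq L -> x < m ->
  (nth 0 (rsk m (below m L)) x == 0) = (x \notin L).
Proof.
move=> uL xm; have [u1 u2] := @below_uniq m L uL.
by have [_ ->] := tableau_rsk u1 u2; rewrite // mem_filter xm.
Qed.

Lemma covers_insert m t v : m < N -> tableau m t -> v < m -> nth 0 t v = 0 ->
  covers (shape N t) (shape N (row_insert t v)).
Proof.
move=> mN tt vm tv; have [tm t1 tl] := tt; rewrite -tm in vm.
have [_ _ il] := tableau_insert vm tv tt.
have := carry_gt1 vm; have := cnt_insert vm tv; set c := carry _ _.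
case: c => [|[|c]] // ci _.
have -> : shape N (row_insert t v) = diagram N (add_cell (fun i => cnt i t) c.+2).
  by apply: eq_diagram => i; rewrite ci.
apply: covers_adds; last exact: (tableau_cnt_lt mN tt).
apply: leq_trans (ltnW mN); rewrite -tm -(size_insert vm); apply: lattice_size => //.
by rewrite mem_cnt ci eqxx addn1.
Qed.

(** Stated as a sum over the letters [v] so that it can be substituted under a sum over fillings:
    [t] and [k] determine one tableau and one letter. *)
Lemma insert_unique m t k : m < N -> tableau m t -> young k -> covers k (shape N t) ->
  exists s, [/\ tableau m s, shape N s = k & forall T, tableau m T ->
    \sum_(v <- iota 0 m) [&& shape N T == k, nth 0 T v == 0 & row_insert T v == t] = (T == s)].
Proof.
move=> mN tt yk kt; have [tm t1 tl] := tt.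
have [||e [g [g0 tg kg]]] := covers_down (lattice0_nonincreasing tl) _ _ yk kt.
- exact: tableau_cnt_lt mN tt.
- by rewrite (tableau_cnt_eq0 tt) // ltnW.
have [//|s [v [ss vm sv st sg]]] := @insert_onto m t e.+2 g tt _ g0 tg.
have sk : shape N s = k by rewrite kg; apply: eq_diagram.
exists s; split=> // T TT.
transitivity (\sum_(u <- iota 0 m) (T == s) * (u == v)).
  rewrite big_seq [RHS]big_seq; apply: eq_bigr => u; rewrite mem_iota => /andP[_ um].
  rewrite mulnb; congr nat_of_bool; apply/and3P/andP.
    case=> /eqP Tk /eqP Tu /eqP Tt.
    have [||-> ->] := @insert_inj m T s u v TT ss um vm Tu sv; rewrite ?st ?Tt ?eqxx //.
    by apply: (shape_cnt mN TT ss); rewrite Tk.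
  by case=> /eqP-> /eqP->; rewrite sk sv st !eqxx.
rewrite -big_distrr /= (eq_bigr (fun u => if u == v then 1 else 0)); last first.
  by move=> u _; case: (u == v).
rewrite -big_mkcond sum1_count count_uniq_mem ?iota_uniq // mem_iota.
by rewrite vm muln1.
Qed.

(** The counterpart for a closing, seen backwards: the entry [m] is put back into the row in which
    [k] exceeds the shape of [t]. *)
Lemma extend_unique m t k : m.+1 < N -> tableau m t -> young k -> covers (shape N t) k ->
  exists s, [/\ tableau m.+1 s, shape N s = k & forall T, tableau m.+1 T ->
    [&& shape N T == k, nth 0 T m != 0 & take m T == t] = (T == s)].
Proof.
move=> mN tt yk kt; have [tm t1 tl] := tt.
have [e [eN te kE]] := covers_up (lattice0_nonincreasing tl) yk kt.
have sk j : shape N (rcons t j.+2) = diagram N (add_cell (fun i => cnt i t) j.+2).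
  by apply: eq_diagram => i; rewrite cnt_rcons.
have ts : tableau m.+1 (rcons t e.+2).
  split; [by rewrite size_rcons tm | by rewrite mem_rcons inE |].
  by apply/lattice_rcons.
exists (rcons t e.+2); split=> [||T TT]; rewrite ?sk // .
apply/and3P/eqP => [[/eqP Tk Tm /eqP Tt] | ->]; last first.
  by rewrite sk kE nth_rcons tm ltnn !eqxx -cats1 take_size_cat // eqxx.
have [sT T1 Tl] := TT.
have TE : T = rcons t (nth 0 T m) by rewrite -Tt -take_nth ?sT // take_oversize ?sT.
case: (nth 0 T m) Tm TE => [|[|j]] // _ TE.
  by move: T1; rewrite TE mem_rcons inE eqxx.
have := shape_cnt mN TT ts; rewrite sk -kE => /(_ Tk e).
rewrite TE !cnt_rcons eqxx => /eqP; rewrite eqn_add2l.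
by case: (j.+2 =P e.+2) => // ->.
Qed.

(** The right side sees only the shape of [t]. Each closing undone raises [m] by one, so
    [m + count negb r] is the largest tableau size met on the way. *)
Lemma count_fillings a b r m t : m + count negb r < N -> tableau m t ->
  \sum_(L <- fillings a b r m) (rsk m (below m L) == t) = walks a b r (shape N t).
Proof.
elim: r m t => [|[] r IHr] m t mN tt /=.
- rewrite big_seq1; congr nat_of_bool; have [tm t1 tl] := tt.
  apply/eqP/eqP => [<-|t0].
    apply/setP => c; rewrite !inE /rsk /=; apply/negbTE; rewrite -leqNgt.
    rewrite (_ : cnt _ _ = 0) //; apply/eqP; rewrite -leqn0 leqNgt -mem_cnt.
    by rewrite mem_nseq andbF.
  rewrite /rsk /=; have /all_pred1P -> : all (pred1 0) t; last by rewrite tm.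
  apply/allP => -[|[|i]] // it; first by rewrite it in t1.
  have iN : i < N by have := lattice_size tl it; move: mN; rewrite tm /=; lia.
  have /setP/(_ (Ordinal iN, Ordinal (leq_ltn_trans (leq0n _) iN))) := t0.
  by rewrite !inE /= -mem_cnt it.
- rewrite /= add0n in mN; have mN' : m < N by apply: leq_ltn_trans mN; apply: leq_addr.
  rewrite big_filter big_mkcond big_allpairs_dep /=.
  (* The fillings are split according to the shape [k] before the opening; for each of them at most
     one term of the new sum survives. *)
  transitivity (bounded_tableau a b t * \sum_(k | young k && covers k (shape N t))
    \sum_(L <- fillings a b r m) \sum_(v <- iota 0 m)
     [&& shape N (rsk m (below m L)) == k, nth 0 (rsk m (below m L)) v == 0
       & row_insert (rsk m (below m L)) v == t]).
    rewrite [in RHS]exchange_big big_distrr /= big_seq [RHS]big_seq.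
    apply: eq_bigr => L /uniq_fillings uL.
    rewrite [in RHS]exchange_big big_distrr /= big_seq [RHS]big_seq.
    apply: eq_bigr => v; rewrite mem_iota => /andP[_ vm].
    rewrite rcons_uniq uL andbT /below filter_rcons vm -/(below _ _) rsk_rcons.
    have TT := tableau_below m uL; have [sT T1 Tl] := TT.
    rewrite -(nth_below uL vm); set T := rsk m _ in TT sT T1 Tl *.
    case: eqP => [T0|_] /=; last by rewrite big1 ?muln0 // => k _; rewrite andbF.
    case: eqP => [<-|_]; last by rewrite big1 ?muln0 ?if_same // => k _; rewrite andbF.
    case: bounded_tableau; rewrite ?mul0n // mul1n.
    rewrite (bigD1 (shape N T)) /=; last first.
      by rewrite (young_shape _ TT) (covers_insert mN' TT).
    rewrite eqxx big1 ?addn0 // => k /andP[_ /negbTE kT].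
    by rewrite eq_sym kT.
  rewrite (bounded_tableau_fits _ _ mN' tt); congr (_ * _); apply: eq_bigr => k /andP[yk kt].
  have [s [ss sk sE]] := insert_unique mN' tt yk kt.
  rewrite -sk -(IHr m s) // sk big_seq [RHS]big_seq; apply: eq_bigr => L /uniq_fillings uL.
  by apply: sE; apply: tableau_below.
rewrite /= add1n addnS -addSn in mN.
have mN' : m.+1 < N by apply: leq_ltn_trans mN; apply: leq_addr.
rewrite big_filter big_mkcond /=.
transitivity (\sum_(k | young k && covers (shape N t) k)
    \sum_(L <- fillings a b r m.+1)
     [&& shape N (rsk m.+1 (below m.+1 L)) == k, nth 0 (rsk m.+1 (below m.+1 L)) m != 0
       & take m (rsk m.+1 (below m.+1 L)) == t]).
  rewrite [in RHS]exchange_big /= big_seq [RHS]big_seq.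
  apply: eq_bigr => L /uniq_fillings uL.
  have TT := tableau_below m.+1 uL; have [sT T1 Tl] := TT.
  have [u1 u2] := @below_uniq m.+1 L uL.
  have -> : rsk m (below m L) = take m (rsk m.+1 (below m.+1 L)).
    rewrite take_rsk //; congr rsk; rewrite /below -filter_predI; apply: eq_filter => x /=.
    by case: ltnP => // /ltnW; rewrite ltnS => ->.
  rewrite -[m \in L]negbK -(nth_below uL (ltnSn m)).
  set T := rsk m.+1 _ in TT sT T1 Tl *.
  case: eqP => [T0|/eqP T0] /=; first by rewrite big1 // => k _; rewrite andbF.
  case: eqP => [Tt|_]; last by rewrite big1 // => k _; rewrite andbF.
  rewrite (bigD1 (shape N T)) /=; last first.
    rewrite (young_shape _ TT) /=.
    have TE : T = rcons t (nth 0 T m) by rewrite -Tt -take_nth ?sT // take_oversize ?sT.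
    have : nth 0 T m \in T by rewrite mem_nth ?sT.
    case: (nth 0 T m) T0 TE => [|[|j]] // _ TE jT; first by rewrite jT in T1.
    have -> : shape N T = diagram N (add_cell (fun i => cnt i t) j.+2).
      by apply: eq_diagram => i; rewrite TE cnt_rcons.
    apply: covers_adds; last exact: tableau_cnt_lt (ltnW mN') tt _.
    by have := lattice_size Tl jT; rewrite sT => /leq_trans; apply; apply: ltnW.
  rewrite eqxx big1 ?addn0 // => k /andP[_ /negbTE kT].
  by rewrite eq_sym kT.
apply: eq_bigr => k /andP[yk kt].
have [s [ss sk sE]] := extend_unique mN' tt yk kt.
rewrite -sk -(IHr m.+1 s) // sk big_seq [RHS]big_seq; apply: eq_bigr => L /uniq_fillings uL.
by rewrite sE //; apply: tableau_below.
Qed.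
End Count.


(** * Rook placements on Ferrers boards *)

Lemma size_fillings_sym a b r :
  size (fillings a b r 0) = size (fillings b a r 0).
Proof.
set N := (count negb r).+1.
(* For [m = 0] no arc is open any more: every filling has the empty tableau, so all are counted. *)
have E x y : size (fillings x y r 0) = walks x y r (shape N [::]).
  rewrite -(@count_fillings N x y r 0 [::] (ltnSn _) (tableau_nseq0 0)).
  rewrite -sum1_size; apply: eq_bigr => L _.
  by have -> : below 0 L = [::] by elim: L.
rewrite !E -(walks_conjugate b a); congr walks.
by apply/setP => c; rewrite in_conjugate !inE.
Qed.

Lemma uniq_fillings_seq a b r m : uniq (fillings a b r m).
Proof.
elim: r m => [|[] r IHr] m //=; last by rewrite filter_uniq.
apply: filter_uniq; apply: allpairs_uniq; rewrite ?iota_uniq //.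
by move=> [L v] [K u] _ _ /= /rcons_inj[-> ->].
Qed.

(** The word [r] is the boundary path of a Ferrers board and these are its row lengths: the label of
    an arc is smaller than the number of arcs still to be closed when it opens. *)
Fixpoint bounds (r : seq bool) (m : nat) : seq nat :=
  match r with
  | [::] => [::]
  | true :: r' => rcons (bounds r' m) m
  | false :: r' => bounds r' m.+1
  end.

Lemma size_bounds r m : size (bounds r m) = count id r.
Proof. by elim: r m => [|[] r IHr] m //=; rewrite ?size_rcons IHr. Qed.

Lemma mem_fillings a b r m L :
  L \in fillings a b r m <->
  [/\ size L = count id r, uniq L,
      forall x, m <= x < m + count negb r -> x \in L &
      forall i, i < size L -> nth 0 L i < nth 0 (bounds r m) i /\
        bounded_tableau a b (rsk (nth 0 (bounds r m) i)
                   (below (nth 0 (bounds r m) i) (take i.+1 L)))].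
Proof.
elim: r m L => [|[] r IHr] m L /=.
- rewrite inE; split=> [/eqP-> | [/size0nil-> //]].
  by split=> // x; lia.
- rewrite mem_filter; split.
    case/andP => /andP[uL gL] /allpairsPdep[K [v [/IHr[sK uK memK H] vm LE]]].
    move: vm; rewrite mem_iota add0n => /andP[_ vm].
    rewrite {}LE in uL gL *; split=> //; first by rewrite size_rcons sK.
      by move=> x xm; rewrite mem_rcons inE memK ?orbT.
    move=> i; rewrite size_rcons ltnS leq_eqVlt => /orP[/eqP->|iK].
      by rewrite !nth_rcons size_bounds sK ltnn eqxx take_oversize ?size_rcons ?sK.
    rewrite !nth_rcons size_bounds -sK iK -cats1 takel_cat //.
    exact: H.
  case; case/lastP: L => // L v; rewrite size_rcons => -[sL] uL memL H.
  rewrite add0n in sL.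
  have := H (size L) (leqnn _).
  rewrite !nth_rcons size_bounds sL ltnn eqxx take_oversize ?size_rcons ?sL // => -[vm gL].
  rewrite uL gL /=; apply/allpairsPdep; exists L, v; split=> //; last by rewrite mem_iota.
  move: uL; rewrite rcons_uniq => /andP[vL uL]; apply/IHr; split=> //.
    move=> x xm; have := memL x xm; rewrite mem_rcons inE => /orP[/eqP xv|//].
    by move: xm vm; rewrite xv; lia.
  move=> i iL; have := H i (ltnW iL).
  by rewrite !nth_rcons size_bounds -sL iL -cats1 takel_cat.
rewrite add0n mem_filter; split.
  case/andP => mL /IHr[sL uL memL H]; split=> // x xm.
  by case: (eqVneq m x) => [<-//|mx]; apply: memL; lia.
case=> sL uL memL H; rewrite memL; last by lia.
by apply/IHr; split=> // x xm; apply: memL; lia.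
Qed.

Lemma bounds_onto n m ms : sorted geq ms -> all (fun x => m <= x <= n) ms -> m <= n ->
  exists2 r, bounds r m = ms & m + count negb r = n.
Proof.
have B k r l : bounds (nseq k false ++ r) l = bounds r (k + l).
  by elim: k l => //= k IHk l; rewrite IHk addnS.
have G : transitive geq by move=> y x z /= xy yz; apply: leq_trans yz xy.
elim/last_ind: ms m => [|ms x IHms] m.
  move=> _ _ mn; exists (nseq (n - m) false); first by have := B (n - m) [::] m; rewrite cats0.
  by rewrite count_nseq; lia.
rewrite sorted_rcons // all_rcons => /andP[xms sms] /andP[/andP[mx xn] ams] mn.
have [|r rE rn] := IHms x sms _ xn.
  apply/allP => y ym; have /andP[_ ->] := allP ams y ym.
  by rewrite andbT; apply: (allP xms y ym).
(* Events are listed backwards, so the shortest row [x], opened last, comes first; [x - m] closings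
   bring the counter from [m] to [x]. *)
exists (nseq (x - m) false ++ true :: r); first by rewrite B /= subnK // rE.
by rewrite count_cat count_nseq /=; lia.
Qed.

(** The last condition concerns the rectangle made of the first [i.+1] rows and as many columns as
    row [i] has. *)
Definition board_filling (n : nat) (ms : seq nat) (a b : nat) (L : seq nat) :=
  [/\ size L = size ms, uniq L, forall x, x < n -> x \in L &
      forall i, i < size L -> nth 0 L i < nth 0 ms i /\
        forall q, subseq q (below (nth 0 ms i) (take i.+1 L)) ->
          (sorted gtn q -> size q <= a) /\ (sorted ltn q -> size q <= b)].

Lemma bounded_tableauP a b m p : uniq p -> all (fun x => x < m) p ->
  bounded_tableau a b (rsk m p) <->
  forall q, subseq q p -> (sorted gtn q -> size q <= a) /\ (sorted ltn q -> size q <= b).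
Proof.
move=> up pm; split=> [/andP[pa pb] q qp | H].
  split=> sq; [apply: leq_trans pa | apply: leq_trans pb].
    by apply/(lds_rsk _ up pm); exists q.
  by apply/(lis_rsk _ up pm); exists q.
apply/andP; split.
  by have /(lds_rsk _ up pm)[q [qp sq <-]] := leqnn (longest_inc 1 (rsk m p)); apply: (H q qp).1.
by have /(lis_rsk _ up pm)[q [qp sq <-]] := leqnn (cnt 2 (rsk m p)); apply: (H q qp).2.
Qed.

Theorem board_filling_sym n ms : sorted geq ms -> all (fun x => x <= n) ms ->
  exists E : nat -> nat -> seq (seq nat),
    [/\ forall a b, uniq (E a b),
        forall a b L, L \in E a b <-> board_filling n ms a b L
      & forall a b, size (E a b) = size (E b a)].
Proof.
move=> sms ams; have [r rE rn] := @bounds_onto n 0 ms sms ams (leq0n _).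
exists (fun a b => fillings a b r 0); split.
- by move=> a b; apply: uniq_fillings_seq.
- move=> a b L; rewrite mem_fillings rE -(size_bounds r 0) rE rn.
  split=> -[sL uL memL H]; split=> // i iL; have [Hi Gi] := H i iL; split=> //.
    apply/(@bounded_tableauP a b (nth 0 ms i)) => //; rewrite ?filter_all // filter_uniq //.
    exact: take_uniq.
  apply/(@bounded_tableauP a b (nth 0 ms i)) => //; rewrite ?filter_all // filter_uniq //.
  exact: take_uniq.
- by move=> a b; apply: size_fillings_sym.
Qed.


(** * Openers and closers *)

Section Arcs.
Variable n : nat.
Implicit Types (u v w : vertex n) (s : {perm vertex n}).

Definition vlt v w : bool := (lab v < lab w)%R.
Definition vle v w : bool := (lab v <= lab w)%R.

Lemma lab_inj : injective (@lab n).
Proof.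
move=> [[] i] [[] j]; rewrite /lab /= => ij; try lia.
  by congr (_, _); apply: val_inj => /=; lia.
by congr (_, _); apply: val_inj => /=; lia.
Qed.

Lemma vle_refl v : vle v v.
Proof. exact: Order.POrderTheory.lexx. Qed.

Lemma vlt_irr : irreflexive vlt.
Proof. by move=> v; apply: Order.POrderTheory.ltxx. Qed.

Lemma vlt_trans : transitive vlt.
Proof. by move=> w u v; apply: Order.POrderTheory.lt_trans. Qed.

Lemma vle_trans : transitive vle.
Proof. by move=> w u v; apply: Order.POrderTheory.le_trans. Qed.

Lemma vltW v w : vlt v w -> vle v w.
Proof. exact: Order.POrderTheory.ltW. Qed.

Lemma vltNge v w : vlt v w = ~~ vle w v.
Proof. exact: Order.TotalTheory.ltNge. Qed.

Lemma vle_anti v w : vle v w -> vle w v -> v = w.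
Proof.
by move=> vw wv; apply: lab_inj; apply: Order.POrderTheory.le_anti; apply/andP.
Qed.

Lemma vlt_neqAle v w : vlt v w = (v != w) && vle v w.
Proof.
by rewrite /vlt Order.POrderTheory.lt_neqAle (inj_eq lab_inj).
Qed.

Lemma lab_vopp v : lab (vopp v) = (- lab v)%R.
Proof. by case: v => [[] i]; rewrite /lab /= ?GRing.opprK. Qed.

Lemma lab_lt0 v : (lab v < 0)%R = v.1.
Proof. by case: v => [[] i]; rewrite /lab /=; lia. Qed.

Lemma vle_vopp v w : vle (vopp v) (vopp w) = vle w v.
Proof. by rewrite /vle !lab_vopp Num.Theory.lerN2. Qed.

Lemma voppK : involutive (@vopp n).
Proof. by case=> b i; rewrite /vopp /= negbK. Qed.

(* A loop of Upp(s) may only sit at a positive vertex. *)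
Definition compat v w : bool := vle v w && ~~ (v.1 && (v == w)).

(** Negation reverses the order, and for a loop the sign decides. Hence exactly one of two opposite
    arcs lies in [Upp]. *)
Lemma compat_vopp v w : compat (vopp v) (vopp w) = ~~ compat v w.
Proof.
rewrite /compat vle_vopp (inj_eq (inv_inj voppK)) /=.
case: (eqVneq v w) => [->|vw]; first by rewrite vle_refl !andbT /= negbK.
by rewrite !andbF !andbT -vltNge vlt_neqAle eq_sym vw.
Qed.

Lemma compat_vle v v' w w' : vle v' v -> vle w w' -> compat v w -> compat v' w'.
Proof.
move=> vv ww /andP[vw nvw]; apply/andP; split.
  exact: vle_trans vv (vle_trans vw ww).
apply: contra nvw => /andP[v1 /eqP vw']; subst w'.
have E1 : v' = v := vle_anti vv (vle_trans vw ww).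
have E2 : w = v' by apply: vle_anti => //; apply: vle_trans vv vw.
by rewrite E2 -E1 v1 eqxx.
Qed.

Lemma mem_vertices v : v \in vertices n.
Proof.
rewrite mem_cat; case: v => [[] i]; apply/orP; [left | right]; last first.
  by apply/mapP; exists i => //; rewrite mem_enum.
by apply/mapP; exists i => //; rewrite mem_rev mem_enum.
Qed.

Lemma sorted_vertices : sorted vlt (vertices n).
Proof.
rewrite (sorted_pairwise vlt_trans) pairwise_cat; apply/and3P; split.
- by apply/allrelP => v w /mapP[i _ ->] /mapP[j _ ->]; rewrite /vlt /lab /=; lia.
- rewrite -(sorted_pairwise vlt_trans) map_rev rev_sorted sorted_map.
  have : sorted ltn (map val (enum 'I_n)) by rewrite val_enum_ord iota_ltn_sorted.
  by rewrite sorted_map; apply: sub_sorted => i j; rewrite /vlt /lab /=; lia.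
rewrite -(sorted_pairwise vlt_trans) sorted_map.
have : sorted ltn (map val (enum 'I_n)) by rewrite val_enum_ord iota_ltn_sorted.
by rewrite sorted_map; apply: sub_sorted => i j; rewrite /vlt /lab /=; lia.
Qed.

Definition opener s v := compat v (s v).
Definition closer s v := compat ((s^-1)%g v) v.

Lemma closer_perm s v : closer s (s v) = opener s v.
Proof. by rewrite /closer permK. Qed.

Lemma in_Bn s : reflect (forall v, s (vopp v) = vopp (s v)) (s \in Bn n).
Proof.
by rewrite inE; apply: (iffP forallP) => H v; apply/eqP.
Qed.

Lemma opener_vopp s v : s \in Bn n -> opener s (vopp v) = ~~ opener s v.
Proof. by move=> /in_Bn sB; rewrite /opener sB compat_vopp. Qed.

Lemma closer_vopp s v : s \in Bn n -> closer s (vopp v) = ~~ closer s v.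
Proof.
move=> sB; rewrite -[v](permKV s) -(in_Bn _ sB) !closer_perm.
exact: opener_vopp.
Qed.

Lemma mem_Upp s e : (e \in Upp s) = (e.2 == s e.1) && compat e.1 e.2.
Proof.
rewrite inE /compat lab_lt0; case: eqP => [->|] //=.
by rewrite [s e.1 == _]eq_sym.
Qed.

Lemma card_set_if (T : finType) (A : {set T}) (x : T) (b : bool) :
  (forall y, (y \in A) = (y == x) && b) -> #|A| = b.
Proof.
case: b => H /=; [rewrite -(cards1 x) | rewrite -(cards0 T)]; apply: eq_card => y.
  by rewrite H inE andbT.
by rewrite H inE andbF.
Qed.

Lemma outdegreeE s v : outdegree s v = opener s v.
Proof.
apply: (@card_set_if _ _ (v, s v)) => -[x y]; rewrite in_set mem_Upp /=.
apply/andP/andP => [[/andP[/eqP-> xs] /existsP[w /andP[/orP[]/eqP[xv sw] vw]]]|].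
- by rewrite -xv; split.
(* An arc that ends at [v] and whose source is not to the left of [v] is a loop. *)
- have wv : w = v by apply: vle_anti vw; have /andP[] := xs; rewrite sw xv.
  by rewrite -wv -xv; split.
case=> /eqP[-> ->] o; rewrite eqxx; split=> //.
by apply/existsP; exists (s v); rewrite /joins eqxx; case/andP: o.
Qed.

Lemma indegreeE s v : indegree s v = closer s v.
Proof.
apply: (@card_set_if _ _ ((s^-1)%g v, v)) => -[x y]; rewrite in_set mem_Upp /=.
apply/andP/andP => [[/andP[/eqP-> xs] /existsP[w /andP[/orP[]/eqP[xv sw] vw]]]|].
- have wv : w = v by apply: vle_anti => //; have /andP[] := xs; rewrite sw xv.
  by rewrite -wv -sw closer_perm permK; split.
- by rewrite -sw closer_perm permK; split.
case=> /eqP[-> ->] o; rewrite permKV eqxx; split=> //.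
by apply/existsP; exists ((s^-1)%g v); rewrite /joins eqxx orbT; case/andP: o.
Qed.

Lemma degree_sequenceP s t :
  reflect (forall v, opener s v = opener t v /\ closer s v = closer t v)
          (degree_sequence s == degree_sequence t).
Proof.
have E (b c : bool) : b = c :> nat -> b = c by case: b; case: c.
apply: (iffP eqP) => [st' v | st].
  have /eq_in_map st := st'.
  have := st v (mem_vertices v); rewrite !indegreeE !outdegreeE.
  by case=> /E-> /E->.
apply: eq_map => v; have [so sc] := st v.
by rewrite !indegreeE !outdegreeE so sc.
Qed.

Definition alike t s :=
  s \in Bn n /\ forall v, opener s v = opener t v /\ closer s v = closer t v.

Lemma in_Bnd t s : t \in Bn n -> s \in Bnd n (degree_sequence t) <-> alike t s.
Proof.
by move=> tB; rewrite in_set; split=> [/andP[? /degree_sequenceP] | [-> /degree_sequenceP]].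
Qed.

(** [neg] counts the arcs of [Upp] from a negative to a positive vertex. The other arcs with a
    negative source end at the negative closers, so [neg] is the difference between the numbers of
    negative openers and negative closers. *)
Lemma neg_alike t s : t \in Bn n -> alike t s -> neg s = neg t.
Proof.
pose nO r := #|[set v | opener r v & v.1]|; pose nC r := #|[set v | closer r v & v.1]|.
have oneg r v : opener r v -> (r v).1 -> v.1.
  by move=> /andP[vr _]; rewrite -!lab_lt0; apply: Order.POrderTheory.le_lt_trans.
have H r : r \in Bn n -> neg r + nC r = nO r.
  move=> rB; rewrite /nO -(cardsID (r @^-1: [set v | v.1])) addnC; congr (_ + _).
    rewrite /nC -[in LHS](card_preimset _ (@perm_inj _ r)); apply: eq_card => v.
    rewrite !inE closer_perm; case: (boolP (opener r v)) => //= /oneg.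
    by case: (r v).1 => [->|_] //; rewrite andbF.
  have rE j : r (true, j) = vopp (r (vpos j)) by exact: (in_Bn _ rB (vpos j)).
  have negI : injective (fun i : 'I_n => vopp (vpos i)) by move=> i j [].
  rewrite /neg -(card_imset _ negI).
  apply: eq_card => -[b i]; rewrite !inE; apply/imsetP/and3P.
    case=> j; rewrite inE lab_lt0 => r1 [-> ->]; rewrite rE /= r1; split=> //.
    rewrite -[(true, j)]/(vopp (vpos j)) opener_vopp //.
    by apply/negP => /oneg/(_ r1).
  case; case: b => // r1 _ _; exists i => //; rewrite inE lab_lt0.
  by move: r1; rewrite rE /= negbK.
move=> tB [sB st]; have := H t tB; have := H s sB.
have -> : nO s = nO t by apply: eq_card => v; rewrite !inE (st v).1.
have -> : nC s = nC t by apply: eq_card => v; rewrite !inE (st v).2.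
by move=> <- /eqP; rewrite eqn_add2r => /eqP.
Qed.
End Arcs.


(** * Crossings and nestings as chains of arcs *)

Definition flip (T : Type) (rv : bool) (l : seq T) : seq T := if rv then rev l else l.

Lemma map_flip (T U : Type) (f : T -> U) rv l : map f (flip rv l) = flip rv (map f l).
Proof. by case: rv; rewrite /= ?map_rev. Qed.

Lemma flipK (T : Type) rv : involutive (@flip T rv).
Proof. by case: rv => // l; apply: revK. Qed.

Lemma size_flip (T : Type) rv (l : seq T) : size (flip rv l) = size l.
Proof. by case: rv; rewrite /= ?size_rev. Qed.

Lemma mem_flip (T : eqType) rv (l : seq T) : flip rv l =i l.
Proof. by case: rv => // x; rewrite /= mem_rev. Qed.

Section ArcChains.
Variable n : nat.
Variable v0 : vertex n.
Implicit Types (u v w : vertex n) (s : {perm vertex n}) (a : seq 'I_n).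

(* Crossing arcs for rv = false, nested arcs for rv = true. *)
Definition arc_chain rv s (xs : seq (vertex n)) : bool :=
  [&& sorted (@vlt n) xs, sorted (@vlt n) (flip rv (map s xs))
    & compat (last v0 xs) (head v0 (flip rv (map s xs)))].

Definition vneg (i : 'I_n) : vertex n := vopp (vpos i).

Lemma increasing_labs (xs : seq (vertex n)) : increasing (labs xs) = sorted (@vlt n) xs.
Proof. by rewrite /increasing sorted_map. Qed.

Lemma labs_flip rv (xs : seq (vertex n)) : flip rv (labs xs) = labs (flip rv xs).
Proof. by rewrite /labs map_flip. Qed.

Lemma last_labs (xs : seq (vertex n)) : xs != [::] -> last 0%R (labs xs) = lab (last v0 xs).
Proof. by case: xs => //= x xs _; rewrite last_map. Qed.

Lemma head_labs (xs : seq (vertex n)) : xs != [::] -> head 0%R (labs xs) = lab (head v0 xs).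
Proof. by case: xs. Qed.

Lemma size_signed r a : size (signed r a) = size a.
Proof. by rewrite size_cat !size_map -size_cat cat_take_drop. Qed.

(** For [r < size a] the last source is positive, and there [compat] is the weak inequality of
    [chain]. *)
Lemma chain_signed rv s r a : r < size a ->
  chain (labs (signed r a)) (flip rv (labs (map s (signed r a)))) =
  arc_chain rv s (signed r a).
Proof.
move=> ra; have a0 : size a != 0 by rewrite -lt0n (leq_trans _ ra).
rewrite /chain labs_flip !increasing_labs last_labs; last by rewrite -size_eq0 size_signed.
rewrite head_labs; last by rewrite -size_eq0 size_flip size_map size_signed.
rewrite /arc_chain /compat -/(vle _ _); congr [&& _, _ & _].
have -> : (last v0 (signed r a)).1 = false; last by rewrite andbT.
rewrite last_cat; case: (drop r a) (size_drop r a) => [|i l _]; first by rewrite /=; lia.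
by rewrite /= last_map.
Qed.

(** Here the last source is negative, and [compat] is the strict inequality needed between the two
    halves. *)
Lemma chain_negative rv s (b : seq 'I_n) : b != [::] ->
  increasing (labs (map vneg b) ++ flip rv (labs (map s (map vneg b)))) =
  arc_chain rv s (map vneg b).
Proof.
move=> b0; rewrite labs_flip /labs -map_cat increasing_labs.
rewrite /arc_chain; set ys := flip rv _.
have : ys != [::] by rewrite -size_eq0 size_flip !size_map size_eq0.
case: ys => // y ys _; case: b b0 => // i b _ /=.
rewrite cat_path /=; congr (_ && _); rewrite andbC; congr (_ && _).
rewrite last_map /compat vlt_neqAle andbC; congr (_ && _).
Qed.

Lemma signed_nil a : signed (size a) a = map vneg a.
Proof. by rewrite /signed take_size drop_size cats0. Qed.

Lemma increasing_opp (l : seq int) : increasing (map (@GRing.opp int) (rev l)) = increasing l.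
Proof.
rewrite /increasing map_rev rev_sorted sorted_map; apply: eq_sorted => x y.
by rewrite /= Num.Theory.ltrN2.
Qed.

Lemma labs_opp (xs : seq (vertex n)) : map (@GRing.opp int) (labs xs) = labs (map (@vopp n) xs).
Proof. by rewrite /labs -!map_comp; apply: eq_map => v /=; rewrite lab_vopp. Qed.

Lemma rev_flip (T : Type) rv (l : seq T) : rev (flip (~~ rv) l) = flip rv l.
Proof. by case: rv; rewrite /= ?revK. Qed.

(* Negating all the labels turns the third alternative of the definitions of crossings and
   nestings into the shape of the second one, with all arcs starting at negative vertices. *)
Lemma all_negative rv s a : s \in Bn n ->
  increasing (rev (labs (map s (map (@vpos n) a))) ++ flip (~~ rv) (labs (map (@vpos n) a))) =
  increasing (labs (map vneg (flip rv a)) ++ flip rv (labs (map s (map vneg (flip rv a))))).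
Proof.
move=> sB; rewrite -increasing_opp rev_cat map_cat revK rev_flip (map_flip (@GRing.opp int)) !labs_opp.
have E : map (@vopp n) (map s (map (@vpos n) a)) = map s (map vneg a).
  by rewrite -!map_comp; apply: eq_map => i /=; rewrite /vneg (in_Bn _ sB).
have F : map (@vopp n) (map (@vpos n) a) = map vneg a by rewrite -!map_comp.
by rewrite E F !labs_flip !map_flip flipK.
Qed.

Definition chain_seq rv s a : bool :=
  if rv then nesting_seq s a else crossing_seq s a.

Lemma signed0 a : signed 0 a = map (@vpos n) a.
Proof. by rewrite /signed take0 drop0. Qed.

Lemma chain_seqP rv s a : s \in Bn n -> a != [::] ->
  chain_seq rv s a <->
  (exists2 r, r < size a & arc_chain rv s (signed r a)) \/
  arc_chain rv s (map vneg (flip rv a)).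
Proof.
move=> sB a0.
have fa0 : flip rv a != [::] by rewrite -size_eq0 size_flip size_eq0.
have -> : chain_seq rv s a = [|| chain (labs (signed 0 a)) (flip rv (labs (map s (signed 0 a)))),
      [exists r : 'I_(size a), (0 < r)%N && chain (labs (signed r a)) (flip rv (labs (map s (signed r a))))]
    | increasing (rev (labs (map s (signed 0 a))) ++ flip (~~ rv) (labs (signed 0 a)))].
  by case: rv {fa0}.
have sa : 0 < size a by rewrite lt0n size_eq0.
rewrite chain_signed // signed0 all_negative // chain_negative // -signed0.
split=> [/or3P[c | /existsP[r /andP[_ c]] | c] | [[[|r] ra c] | c]].
- by left; exists 0.
- by left; exists r => //; rewrite -chain_signed.
- by right.
- by rewrite c.
- apply/or3P; apply: Or32; apply/existsP; exists (Ordinal ra) => /=.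
  by rewrite chain_signed.
- by rewrite c !orbT.
Qed.

Lemma signed_sorted (xs : seq (vertex n)) : sorted (@vlt n) xs ->
  xs = signed (count fst xs) (map snd xs).
Proof.
elim: xs => //= x xs IHxs xp; have xs_sorted := path_sorted xp.
case: x xp => [[] i] xp /=; first by rewrite /signed /= {1}IHxs.
have pos : all (fun v => ~~ v.1) xs.
  have := order_path_min (@vlt_trans n) xp; apply: sub_all => v.
  by rewrite /vlt /lab /=; case: v.1; lia.
have -> : count fst xs = 0.
  by apply/eqP; rewrite -leqn0 leqNgt -has_count -all_predC.
rewrite /= add0n signed0 /=; congr (_ :: _).
rewrite -map_comp -[LHS]map_id; apply/eq_in_map => -[b j] /(allP pos) /=.
by case: b.
Qed.

Definition is_chain rv s (A : {set 'I_n}) : bool :=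
  if rv then is_nesting s A else is_crossing s A.

Lemma is_chainP rv s A :
  is_chain rv s A <-> exists a, [/\ size a = #|A|, [set i in a] = A & chain_seq rv s a].
Proof.
have H (P : pred (seq 'I_n)) :
    [exists a : #|A|.-tuple 'I_n, ([set i in a] == A) && P a] <->
    exists a, [/\ size a = #|A|, [set i in a] = A & P a].
  split=> [/existsP[a /andP[/eqP aA Pa]] | [a [sa aA Pa]]].
    by exists a; rewrite size_tuple.
  by apply/existsP; exists (Tuple (introT eqP sa)); rewrite aA eqxx.
by case: rv; apply: H.
Qed.

Lemma vle_last (l : seq (vertex n)) v : sorted (@vlt n) l -> v \in l -> vle v (last v0 l).
Proof.
case/lastP: l => // l z; rewrite (sorted_pairwise (@vlt_trans n)) pairwise_rcons.
rewrite last_rcons mem_rcons inE => /andP[lz _] /orP[/eqP->|vl]; first exact: vle_refl.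
by apply: vltW; apply: (allP lz).
Qed.

Lemma arc_chain_le rv s xs x y : arc_chain rv s xs -> x \in xs -> y \in xs -> compat x (s y).
Proof.
case/and3P=> xsorted ysorted c xx yx.
have heads (l : seq (vertex n)) v : sorted (@vlt n) l -> v \in l -> vle (head v0 l) v.
  case: l => //= z l zl; rewrite inE => /orP[/eqP->|vl]; first exact: vle_refl.
  by apply: vltW; apply: (allP (order_path_min (@vlt_trans n) zl)).
apply: compat_vle c; first exact: vle_last.
by apply: heads => //; rewrite mem_flip map_f.
Qed.

(** Only positive sizes occur, because [arc_chain] compares default values on the empty sequence. *)
Lemma chain_set rv s k : s \in Bn n ->
  (exists2 A, is_chain rv s A & #|A| = k.+1) <->
  (exists2 xs, arc_chain rv s xs & size xs = k.+1).
Proof.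
move=> sB; split=> [[A /is_chainP[a [sa aA ca]] Ak] | [xs c sx]].
  have a0 : a != [::] by rewrite -size_eq0 sa Ak.
  have [[r ra c]|c] := (chain_seqP rv sB a0).1 ca.
    by exists (signed r a) => //; rewrite size_signed sa.
  by exists (map vneg (flip rv a)) => //; rewrite size_map size_flip sa.
have xs0 : xs != [::] by rewrite -size_eq0 sx.
have us : uniq (map snd xs).
  rewrite map_inj_in_uniq => [|[b i] [c' j] ix jx /= ij].
    apply: (sorted_uniq (@vlt_trans n) (@vlt_irr n)); by case/and3P: c.
  (* Two sources with the same absolute value would be opposite vertices, of which only one is an
     opener. *)
  subst j; case: (eqVneq b c') => [->//|bc].
  have Eo : (b, i) = vopp (c', i) by rewrite /vopp /=; case: b c' {ix jx} bc => [] [].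
  have := arc_chain_le c jx jx; rewrite -[compat _ _]/(opener s (c', i)) => o.
  have := arc_chain_le c ix ix; rewrite -[compat _ _]/(opener s (b, i)).
  by rewrite Eo opener_vopp // o.
have E := signed_sorted (andP c).1; set r := count fst xs in E; set b := map snd xs in us E.
have sb : size b = k.+1 by rewrite size_map.
have G a : uniq a -> size a = k.+1 -> #|[set i in a]| = k.+1.
  by move=> ua sa; rewrite cardsE (card_uniqP ua).
have : r <= size b by rewrite /r /b size_map count_size.
rewrite leq_eqVlt => /orP[/eqP rb | rb].
  have fb : size (flip rv b) = k.+1 by rewrite size_flip.
  have fu : uniq (flip rv b) by rewrite /flip; case: rv {c fb}; rewrite ?rev_uniq.
  exists [set i in flip rv b]; last exact: G.
  apply/is_chainP; exists (flip rv b); rewrite G //; split=> //.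
  apply/chain_seqP => //; first by rewrite -size_eq0 fb.
  by right; rewrite flipK -signed_nil -rb -E.
exists [set i in b]; last exact: G.
apply/is_chainP; exists b; rewrite G //; split=> //.
apply/chain_seqP => //; first by rewrite -size_eq0 sb.
by left; exists r; rewrite // -E.
Qed.

Definition stat rv s := if rv then nes s else cro s.

Lemma stat_le rv s m : s \in Bn n ->
  stat rv s <= m <-> forall xs, arc_chain rv s xs -> xs != [::] -> size xs <= m.
Proof.
move=> sB; have -> : stat rv s = \max_(A | is_chain rv s A) #|A| by case: rv.
split=> [/bigmax_leqP H xs c x0 | H].
  case sx: (size xs) => [|k] //; rewrite -sx.
  have [A cA Ak] := (chain_set rv k sB).2 (ex_intro2 _ _ xs c sx).
  by rewrite sx -Ak; apply: H.
apply/bigmax_leqP => A cA; case Ak: #|A| => [|k] //.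
have [xs c sx] := (chain_set rv k sB).1 (ex_intro2 _ _ A cA Ak).
by rewrite -sx; apply: H => //; rewrite -size_eq0 sx.
Qed.
End ArcChains.


(** * The board of a degree sequence *)

Section Code.
Variables (n : nat) (v0 : vertex n) (t : {perm vertex n}).
Hypothesis tB : t \in Bn n.
Implicit Types (u v w : vertex n) (s : {perm vertex n}) (L : seq nat).

Definition opener_seq := [seq v <- vertices n | opener t v].
Definition closer_seq := rev [seq v <- vertices n | closer t v].

Lemma mem_opener_seq v : (v \in opener_seq) = opener t v.
Proof. by rewrite mem_filter mem_vertices andbT. Qed.

Lemma mem_closer_seq v : (v \in closer_seq) = closer t v.
Proof. by rewrite mem_rev mem_filter mem_vertices andbT. Qed.

Lemma sorted_opener_seq : sorted (@vlt n) opener_seq.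
Proof. exact: sorted_filter (@vlt_trans n) _ _ (sorted_vertices n). Qed.

Lemma sorted_closer_seq : sorted (fun v w => vlt w v) closer_seq.
Proof.
by rewrite rev_sorted; apply: sorted_filter (@vlt_trans n) _ _ (sorted_vertices n).
Qed.

Lemma uniq_opener_seq : uniq opener_seq.
Proof. exact: sorted_uniq (@vlt_trans n) (@vlt_irr n) _ sorted_opener_seq. Qed.

Lemma uniq_closer_seq : uniq closer_seq.
Proof.
rewrite rev_uniq; apply: (sorted_uniq (@vlt_trans n) (@vlt_irr n)).
exact: sorted_filter (@vlt_trans n) _ _ (sorted_vertices n).
Qed.

Lemma index_closer_seq v w : v \in closer_seq -> w \in closer_seq -> (index v closer_seq < index w closer_seq) = vlt w v.
Proof.
have gtr : transitive (fun v w : vertex n => vlt w v).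
  by move=> y x z xy yz; apply: vlt_trans yz xy.
have G x y : x \in closer_seq -> y \in closer_seq -> index x closer_seq < index y closer_seq -> vlt y x.
  by move=> xc yc; apply: (sorted_ltn_index gtr sorted_closer_seq _ _ xc yc).
move=> vc wc; apply/idP/idP; first exact: G.
move=> wv; rewrite ltnNge leq_eqVlt; apply/negP => /orP[/eqP e | /(G _ _ wc vc) vw].
  by rewrite (index_inj v wc vc e) vlt_irr in wv.
by have := vlt_trans wv vw; rewrite vlt_irr.
Qed.

Lemma index_opener_seq v w : v \in opener_seq -> w \in opener_seq -> (index v opener_seq <= index w opener_seq) = vle v w.
Proof.
have G x y : x \in opener_seq -> y \in opener_seq -> index x opener_seq < index y opener_seq -> vlt x y.
  by move=> xc yc; apply: (sorted_ltn_index (@vlt_trans n) sorted_opener_seq _ _ xc yc).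
move=> vc wc; apply/idP/idP.
  rewrite leq_eqVlt => /orP[/eqP e|/(G _ _ vc wc)/vltW //].
  by rewrite (index_inj v vc wc e) vle_refl.
move=> vw; rewrite leqNgt; apply/negP => /(G _ _ wc vc).
by rewrite vltNge vw.
Qed.

(* Since closer_seq is decreasing, the closers compatible with v form an initial segment. *)
Definition height v : nat := find (fun w => ~~ compat v w) closer_seq.
Definition heights := [seq height v | v <- opener_seq].

Lemma index_height v w : w \in closer_seq -> (index w closer_seq < height v) = compat v w.
Proof.
move=> wc; apply/idP/idP => [/(before_find w) | vw].
  by rewrite nth_index // => /negbFE.
rewrite ltnNge; apply/negP => hw.
have hs : has (fun w => ~~ compat v w) closer_seq.
  by rewrite has_find (leq_ltn_trans hw) // index_mem.
have := nth_find w hs; rewrite -/(height v); set z := nth _ _ _.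
have zc : z \in closer_seq by rewrite mem_nth // -has_find.
have zi : index z closer_seq = height v by rewrite index_uniq ?uniq_closer_seq // -has_find.
move/negP; apply; apply: compat_vle vw; first exact: vle_refl.
move: hw; rewrite -zi leq_eqVlt => /orP[/eqP/(index_inj w zc wc)->|]; first exact: vle_refl.
by rewrite index_closer_seq // => /vltW.
Qed.

Lemma size_heights : size heights = size opener_seq. Proof. exact: size_map. Qed.

Lemma heights_le : all (fun x => x <= size closer_seq) heights.
Proof. by rewrite all_map; apply/allP => v _; apply: find_size. Qed.

Lemma sorted_heights : sorted geq heights.
Proof.
rewrite sorted_map; apply: sub_sorted sorted_opener_seq => v w vw /=.
apply: sub_find => z; apply: contra; apply: compat_vle; last exact: vle_refl.
exact: vltW.
Qed.

(** As closers are listed from right to left, the index of a closer is the number of closers to its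
    right: the label used in [fillings]. *)
Definition code s : seq nat := [seq index (s v) closer_seq | v <- opener_seq].

Lemma alike_opener_seq s v : alike t s -> (v \in opener_seq) = opener s v.
Proof. by move=> [_ /(_ v)[-> _]]; rewrite mem_opener_seq. Qed.

Lemma alike_closer_seq s v : alike t s -> (s v \in closer_seq) = (v \in opener_seq).
Proof. by move=> st; rewrite mem_closer_seq -(st.2 (s v)).2 closer_perm (alike_opener_seq _ st). Qed.

(** Vertices that are not openers are opposite to openers, so the values on openers determine a
    signed permutation. *)
Lemma code_inj s s' : alike t s -> alike t s' -> code s = code s' -> s = s'.
Proof.
move=> st st' /eq_in_map ss.
have E v : v \in opener_seq -> s v = s' v.
  by move=> vo; by apply: (index_inj v0) (ss v vo); rewrite alike_closer_seq.
apply/permP => v; case vo: (v \in opener_seq); first exact: E.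
apply: (inv_inj (@voppK n)); rewrite -(in_Bn _ st.1) -(in_Bn _ st'.1); apply: E.
by rewrite mem_opener_seq opener_vopp // -mem_opener_seq vo.
Qed.

Lemma subseq_opener_seq xs k : sorted (@vlt n) xs -> (forall x, x \in xs -> x \in take k opener_seq) ->
  subseq xs (take k opener_seq).
Proof.
move=> sx xo; have -> : xs = [seq x <- take k opener_seq | x \in xs]; last exact: filter_subseq.
apply: (irr_sorted_eq (@vlt_trans n) (@vlt_irr n)) => //.
  apply: sorted_filter; first exact: vlt_trans.
  by apply: take_sorted; apply: sorted_opener_seq.
by move=> x; rewrite mem_filter; case xx: (x \in xs); rewrite //= xo.
Qed.

Lemma sorted_code rv s xs : (forall x, x \in xs -> s x \in closer_seq) ->
  sorted (if rv then ltn else gtn) [seq index (s x) closer_seq | x <- xs] =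
  sorted (@vlt n) (flip rv (map s xs)).
Proof.
move=> xc; have yc : all (mem closer_seq) (map s xs) by apply/allP => _ /mapP[x /xc ? ->].
rewrite (map_comp (fun v => index v closer_seq) s) sorted_map; case: rv => /=.
  by rewrite rev_sorted; apply: eq_in_sorted yc => v w vc wc /=; apply: index_closer_seq.
by apply: eq_in_sorted yc => v w vc wc /=; apply: index_closer_seq.
Qed.

Lemma last_in (l : seq (vertex n)) : l != [::] -> last v0 l \in l.
Proof. by case: l => //= v l _; rewrite mem_last. Qed.

(** In a chain every target is compatible with the last source, so the chain lies in the rectangle
    of that opener. Conversely, in the rectangle of row [i] all sources are weakly left of the
    [i]-th opener and all targets are compatible with it. *)
Lemma code_chains rv s m : alike t s ->
  (forall xs, arc_chain v0 rv s xs -> xs != [::] -> size xs <= m) <->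
  (forall i, i < size opener_seq -> forall q,
     subseq q (below (nth 0 heights i) (take i.+1 (code s))) ->
     sorted (if rv then ltn else gtn) q -> size q <= m).
Proof.
move=> st; split=> H.
  move=> i io q; rewrite subseq_filter -map_take => /andP[qh /subseqP[k _ qE]] qs.
  rewrite -map_mask in qE; set xs := mask k _ in qE.
  have xo x : x \in xs -> x \in take i.+1 opener_seq by apply: mem_mask.
  have xc x : x \in xs -> s x \in closer_seq by move=> /xo/mem_take; rewrite alike_closer_seq.
  case: (eqVneq xs [::]) => [x0|x0]; first by rewrite qE x0.
  rewrite qE size_map; apply: H => //; apply/and3P; split.
  - by apply: sorted_mask; [exact: vlt_trans | apply: take_sorted; apply: sorted_opener_seq].
  - by rewrite -sorted_code // -qE.
  set h := head _ _.
  have /mapP[x xx hE] : h \in map s xs.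
    have y0 : flip rv (map s xs) != [::] by rewrite -size_eq0 size_flip size_map size_eq0.
    by rewrite -(mem_flip rv) /h; case: flip y0 => // y ys _; apply: mem_head.
  rewrite hE; have lx := last_in x0.
  have xi : compat (nth v0 opener_seq i) (s x).
    rewrite -index_height ?xc // -(nth_map v0 0 height) //.
    by apply: (allP qh); rewrite qE; apply: map_f.
  apply: compat_vle xi; last exact: vle_refl.
  rewrite -index_opener_seq ?mem_nth //; last exact: mem_take (xo _ lx).
  by rewrite index_uniq ?uniq_opener_seq // -ltnS; apply: index_ltn; apply: xo.
move=> xs c x0; have [xsorted ysorted _] := and3P c.
have xo x : x \in xs -> x \in opener_seq.
  by move=> xx; rewrite (alike_opener_seq _ st); exact: (arc_chain_le c xx xx).
have xc x : x \in xs -> s x \in closer_seq by move=> /xo; rewrite alike_closer_seq.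
have lx := last_in x0.
set i := index (last v0 xs) opener_seq; have io : i < size opener_seq by rewrite index_mem xo.
rewrite -(size_map (fun x => index (s x) closer_seq)); apply: (H i io); last by rewrite sorted_code.
rewrite subseq_filter -map_take; apply/andP; split.
  rewrite all_map; apply/allP => x xx /=; rewrite (nth_map v0) // nth_index ?xo //.
  by rewrite index_height ?xc //; apply: arc_chain_le c _ xx.
apply: map_subseq; apply: subseq_opener_seq => // x xx.
rewrite in_take ?xo // ltnS index_opener_seq ?xo //.
exact: vle_last.
Qed.
End Code.


(** * Signed permutations as board fillings *)

Section Codes.
Variables (n : nat) (v0 : vertex n) (t : {perm vertex n}).
Hypothesis tB : t \in Bn n.
Implicit Types (u v w : vertex n) (s : {perm vertex n}) (L : seq nat).
Notation opener_seq := (opener_seq t).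
Notation closer_seq := (closer_seq t).
Notation board := (board_filling (size closer_seq) (heights t)).

Lemma code_board a b s : alike t s ->
  board a b (code t s) <-> (cro s <= a) && (nes s <= b).
Proof.
move=> st; have sB := st.1.
have [ca na] : (stat false s <= a <-> _) /\ (stat true s <= b <-> _) :=
  conj (iff_trans (stat_le v0 false a sB) (code_chains v0 false a st))
       (iff_trans (stat_le v0 true b sB) (code_chains v0 true b st)).
split=> [[_ _ _ H] | /andP[/ca Ha /na Hb]].
  apply/andP; split; [apply/ca | apply/na] => i io q qs;
    by have [_ /(_ q qs)[]] := H i (leq_trans io (eq_leq (esym (size_map _ _)))).
split=> [|||i].
- by rewrite !size_map.
- rewrite map_inj_in_uniq ?uniq_opener_seq // => v w vo wo e.
  by apply: (@perm_inj _ s); apply: (index_inj v0) e; rewrite (alike_closer_seq _ st).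
- move=> x xc; apply/mapP; exists ((s^-1)%g (nth v0 closer_seq x)).
    by rewrite -(alike_closer_seq _ st) permKV mem_nth.
  by rewrite permKV index_uniq ?uniq_closer_seq.
rewrite size_map => io; split; last by move=> q qs; split; [exact: (Ha i io q qs) | exact: (Hb i io q qs)].
rewrite !(nth_map v0) // index_height; last by rewrite (alike_closer_seq _ st) mem_nth.
have : nth v0 opener_seq i \in opener_seq by rewrite mem_nth.
by rewrite (alike_opener_seq _ st).
Qed.

Lemma code_onto a b L : board a b L -> exists2 s, alike t s & code t s = L.
Proof.
case=> sL uL memL H.
have so : size L = size opener_seq by rewrite sL size_heights.
have Lc i : i < size L -> nth 0 L i < size closer_seq.
  move=> iL; apply: leq_trans (H i iL).1 _.
  by apply: (all_nthP 0 (heights_le t)); rewrite -sL.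
pose g o := nth v0 closer_seq (nth 0 L (index o opener_seq)).
have io o : o \in opener_seq -> index o opener_seq < size L by rewrite so index_mem.
have gc o : o \in opener_seq -> g o \in closer_seq by move=> oo; rewrite mem_nth ?Lc ?io.
have ig o : o \in opener_seq -> index (g o) closer_seq = nth 0 L (index o opener_seq).
  by move=> oo; rewrite index_uniq ?uniq_closer_seq ?Lc ?io.
have ginj o o' : o \in opener_seq -> o' \in opener_seq -> g o = g o' -> o = o'.
  move=> oo oo' e; apply: (index_inj v0 oo oo'); apply/eqP.
  have e2 : nth 0 L (index o opener_seq) = nth 0 L (index o' opener_seq) by rewrite -(ig o oo) -(ig o' oo') e.
  by rewrite /= -(nth_uniq 0 (io o oo) (io o' oo') uL) e2.
have gcomp o : o \in opener_seq -> compat o (g o).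
  move=> oo; rewrite -(index_height _ (gc o oo)) ig //.
  have := (H _ (io o oo)).1; rewrite (nth_map v0) ?nth_index //.
  by rewrite index_mem.
have oppO v : (vopp v \in opener_seq) = (v \notin opener_seq) by rewrite !mem_opener_seq opener_vopp.
have oppC v : (vopp v \in closer_seq) = (v \notin closer_seq) by rewrite !mem_closer_seq closer_vopp.
pose f v := if v \in opener_seq then g v else vopp (g (vopp v)).
have fC v : (f v \in closer_seq) = (v \in opener_seq).
  rewrite /f; case: ifP => vo; first exact: gc.
  by rewrite oppC gc // oppO vo.
(* Openers go to closers and the other vertices to non-closers, so a collision would occur within
   one of the two classes, where [g] excludes it. *)
have finj : injective f.
  move=> v w e; have := fC v; rewrite e fC; move: e; rewrite /f.
  case: ifP => vo; case: ifP => wo // e _; first exact: ginj.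
  apply: (inv_inj (@voppK n)); apply: ginj; rewrite ?oppO ?vo ?wo //.
  exact: (inv_inj (@voppK n)).
have sE v : perm finj v = f v by rewrite permE.
have sB : perm finj \in Bn n.
  apply/in_Bn => v; rewrite !sE /f oppO; case: (boolP (v \in opener_seq)) => vo /=.
    by rewrite voppK.
  by rewrite voppK.
have sO v : opener (perm finj) v = (v \in opener_seq).
  case: (boolP (v \in opener_seq)) => vo; first by rewrite /opener sE /f vo gcomp.
  rewrite -[v]voppK opener_vopp // /opener sE /f oppO vo gcomp //.
  by rewrite oppO.
exists (perm finj).
  split=> // v; rewrite sO mem_opener_seq; split=> //.
  by rewrite -[v](permKV (perm finj)) closer_perm sO -fC -sE mem_closer_seq.
apply: (@eq_from_nth _ 0); rewrite size_map // => i io'.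
rewrite (nth_map v0) // sE /f mem_nth // ig ?mem_nth // index_uniq //.
exact: uniq_opener_seq.
Qed.

Lemma card_alike_sym a b :
  #|[set s in Bnd n (degree_sequence t) | (cro s <= a) && (nes s <= b)]| =
  #|[set s in Bnd n (degree_sequence t) | (cro s <= b) && (nes s <= a)]|.
Proof.
have [E [uE memE symE]] := board_filling_sym (sorted_heights t) (heights_le t).
suff K x y : #|[set s in Bnd n (degree_sequence t) | (cro s <= x) && (nes s <= y)]| = size (E x y).
  by rewrite !K symE.
set A := [set s in _ | _].
have inA s : s \in A <-> alike t s /\ (cro s <= x) && (nes s <= y).
  by rewrite inE; split=> [/andP[/(in_Bnd _ tB) ? ?] | [/(in_Bnd _ tB) -> ->]].
rewrite cardE -(size_map (code t)); apply/perm_size/uniq_perm => // [|L].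
  rewrite map_inj_in_uniq ?enum_uniq // => s s'; rewrite !mem_enum.
  by move=> /inA[st _] /inA[st' _]; apply: code_inj.
apply/mapP/idP => [[s] | /memE LE].
  by rewrite mem_enum => /inA[st cn] ->; apply/memE/(code_board _ _ st).
have [s st sL] := code_onto LE; exists s => //.
by rewrite mem_enum; apply/inA; split=> //; apply/(code_board _ _ st); rewrite sL.
Qed.
End Codes.

(** * From bounds to exact values *)

Lemma sym_joint (T : finType) (A : {set T}) (f g : T -> nat) :
    (forall a b, #|[set x in A | (f x <= a) && (g x <= b)]| =
                 #|[set x in A | (f x <= b) && (g x <= a)]|) ->
  forall i j, #|[set x in A | (f x == i) && (g x == j)]| =
              #|[set x in A | (f x == j) && (g x == i)]|.
Proof.
move=> H.
(* Strict inequalities spare predecessors: the index 0 gives the empty set. *)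
pose C a b := #|[set x in A | (f x < a) && (g x < b)]|.
have sumE (P : pred T) : #|[set x in A | P x]| = \sum_(x in A) P x.
  rewrite -sum1_card (eq_bigl (fun x => (x \in A) && P x)) ?big_mkcondr => [|x]; last by rewrite inE.
  by apply: eq_bigr => x _; case: (P x).
have Csym a b : C a b = C b a.
  case: a b => [|a] [|b] //; rewrite /C; last exact: H.
    by rewrite !(eq_card0 (A := mem [set x in A | _])) // => x; rewrite !inE ?ltn0 ?andbF.
  by rewrite !(eq_card0 (A := mem [set x in A | _])) // => x; rewrite !inE ?ltn0 ?andbF.
have X i j : C i.+1 j.+1 + C i j =
    C i j.+1 + C i.+1 j + #|[set x in A | (f x == i) && (g x == j)]|.
  rewrite /C !sumE -!big_split; apply: eq_bigr => x _ /=; rewrite !ltnS; lia.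
move=> i j; have := X i j; have := X j i.
rewrite (Csym j.+1 i.+1) (Csym j i) (Csym j i.+1) (Csym j.+1 i).
lia.
Qed.

Theorem theorem2p7 (n : nat) (n_gt0 : (0 < n)%N) (d : seq (nat * nat))
  (i j m : nat) : NC n d i j m = NC n d j i m.
Proof.
case: (set_0Vmem (Bnd n d)) => [B0 | [t tBd]].
  by rewrite /NC B0 !(eq_card0 (A := mem [set s in set0 | _])) // => s; rewrite !inE.
have tB : t \in Bn n by move: tBd; rewrite in_set => /andP[].
have dE : degree_sequence t = d by move: tBd; rewrite in_set => /andP[_ /eqP].
(* Any element [t] of the class can serve as reference; [v0] is a default value, available since [n]
   is positive. *)
rewrite -{d tBd}dE; pose v0 : vertex n := vpos (Ordinal n_gt0).
have negE s : s \in Bnd n (degree_sequence t) -> neg s = neg t.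
  by move=> /(in_Bnd _ tB); apply: neg_alike.
have NCE x y : NC n (degree_sequence t) x y m =
    (neg t == m) * #|[set s in Bnd n (degree_sequence t) | (cro s == x) && (nes s == y)]|.
  case: eqP => [mE | mN]; rewrite ?mul1n ?mul0n.
    apply: eq_card => s; rewrite [LHS]in_set [RHS]in_set.
    by case: (boolP (s \in Bnd _ _)) => //= /negE ->; rewrite mE eqxx andbT.
  apply: eq_card0 => s; rewrite in_set; apply/negP => /and4P[/negE sE _ _ /eqP sm].
  by apply: mN; rewrite -sE.
rewrite !NCE; congr (_ * _).
by apply: sym_joint => a b; apply: card_alike_sym.
Qed.
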